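(* For an $\mathbf{8}$-labelled Fano plane $x$ with basepoint $l$, let $h(x)=H(x)+(8-l)$, where $H(x)$ is the number of odd labels in $x$. Let $z_0=(1\ 8)(2\ 7)(3\ 6)(4\ 5)\in S_8$. (i) Every label in $x$ has a well-defined parity. (ii) Every label in the packing $x_0$ is even, and every label in the packing $x_1$ is odd. We have $h(x_0)=0$ and $h(x_1)=14$. (iii) If $s=(i,i+1)\in S_8$ is a simple reflection, then $h(sx)=h(x)\pm1$. (iv) We have $\mathrm{ht}(x)=h(x)$. (v) Two packings are in the same $A_8$-orbit if and only if their heights are congruent modulo $2$. (vi) For any packing $x\in\Omega_{240}$, any reflection $r\in W(D_8)$, and any pure sign change $t\in W(D_8)$, we have $\mathrm{ht}(rx)\equiv\mathrm{ht}(x)+1 \pmod 2$ and $\mathrm{ht}(tx)\equiv\mathrm{ht}(x)\pmod 2$. (vii) For any packing $x\in\Omega_{240}$, we have $\mathrm{ht}(x)+\mathrm{ht}(z_0x)=14$. (viii) If $x,y\in\Omega_{240}$ are packings such that $x\le y$ in the Bruhat order on packings, then $z_0y\le z_0x$.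
   Context: Write $\mathbf{8}=\{1,\dots,8\}$. An $\mathbf{8}$-labelled Fano plane is a set of seven $3$-element subsets (''triples'') of $\mathbf{8}$ that are the lines of a Fano plane $PG(2,2)$ on seven of the eight labels (the labels in it); the unused label is its basepoint. There are $240$ of these; they index and are identified with the packings of $PG(3,2)$ (partitions of the $35$ lines into seven spreads, a spread being a partition of the $15$ points into five lines). Their set is $\Omega_{240}$. $S_8$ (and $A_8\le S_8$) acts on it by permuting labels. Writing $ijk=\{i,j,k\}$, let $x_0=\{127,136,145,235,246,347,567\}$ (basepoint $8$) and $x_1=\{234,256,278,357,368,458,467\}$ (basepoint $1$). Parity. Let $e$ be a label appearing in $x$, and let $\{e,a_1,b_1\},\{e,a_2,b_2\},\{e,a_3,b_3\}$ be the three triples of $x$ containing $e$, with $a_i<b_i$ for all $i$. Let $f$ be the point of intersection of the line (triple) through $\{a_1,a_2\}$ with the line through $\{b_1,b_2\}$. The label $e$ of $x$ is odd if $\{a_1,a_2,a_3\}$ is a triple of $x$ and $f=a_3$; it is even if $\{b_1,b_2,b_3\}$ is a triple of $x$ and $f=b_3$. The parity of a label is its odd or even status. Height and Bruhat order. $\mathrm{ht}(x)=\min\{\ell(w):w\in S_8,\ wx_0=x\}$, where $\ell$ is the length in $S_8$ with respect to the simple transpositions. For a transposition $t\in S_8$ write $x\prec tx$ if $\mathrm{ht}(x)<\mathrm{ht}(tx)$; the Bruhat order $\le$ on $\Omega_{240}$ is the reflexive, transitive closure of $\prec$. Action of $W(D_8)$. $W(D_8)$ is the group of signed permutations of $8$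 objects involving evenly many sign changes. Its reflections are the transpositions $(i,j)$ and the signed transpositions $\overline{(i,j)}$ (exchange objects $i$ and $j$ and change the sign of each). A pure sign change is an element $w$ with $w(i)\in\{i,\overline{i}\}$ for all $i$, where $\overline{i}$ denotes $i$ with its sign changed. Let $V=\mathbb{F}_2^8/U$, where $\mathbb{F}_2^8$ has basis $\varepsilon_1,\dots,\varepsilon_8$ and $U$ is spanned by the all-ones vector; for $A\subseteq\mathbf{8}$ let $v_A$ be the coset of $\sum_{i\in A}\varepsilon_i$; let $\Lambda^-$ be the set of $v_A$ with $|A|$ odd. For $x\in\Omega_{240}$ with basepoint $l$, $\lambda^-(x)\subset\Lambda^-$ is the set consisting of $v_A$ for the seven triples $A$ of $x$ together with $v_{\{l\}}$; $\lambda^-$ is injective. $W(D_8)$ acts on $\Lambda^-$: unsigned permutations permute coordinates ($\varepsilon_k\mapsto\varepsilon_{w(k)}$) and changing the sign of object $i$ acts as adding $\varepsilon_i$. This induces the action on $\Omega_{240}$ given by $\lambda^-(wx)=w\lambda^-(x)$. *)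

(* Defs.v *)
From HB Require Import structures.
From mathcomp Require Import all_boot all_order all_fingroup all_algebra all_solvable.

Set Implicit Arguments.
Unset Strict Implicit.
Unset Printing Implicit Defensive.

Import GRing.Theory.

(* The labels 1, ..., 8 are the elements 0, ..., 7 of 'I_8, in this order. *)
Definition lb (k : nat) : 'I_8 := inord k.-1.

Definition label_value (i : 'I_8) : nat := i.+1.

Definition tri (i j k : nat) : {set 'I_8} := [set lb i; lb j; lb k].

(* The points of PG(2,2) are the nonzero vectors of F_2^3; over F_2 the line
   through the points u != v is {u, v, u + v}. *)
Definition pg22_lines : {set {set 'rV['F_2]_3}} :=
  [set L : {set 'rV['F_2]_3} | [exists u, exists v,
     [&& u != 0%R, v != 0%R, u != v & L == [set u; v; (u + v)%R]]]].

(* The points of PG(2,2) are labelled by the restriction of f; as f is a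
   bijection from F_2^3 to the labels, f 0 is the unused label. *)
Definition is_labelled_fano (x : {set {set 'I_8}}) : bool :=
  [exists f : {ffun 'rV['F_2]_3 -> 'I_8},
     injectiveb f && (x == [set f @: L | L : {set 'rV['F_2]_3} in pg22_lines])].

Record omega240 := Omega240 {
  triples :> {set {set 'I_8}};
  _ : is_labelled_fano triples }.

HB.instance Definition _ := [isSub for triples].
HB.instance Definition _ := [Finite of omega240 by <:].

Definition labels (x : omega240) : {set 'I_8} := cover x.

Definition basepoint (x : omega240) : 'I_8 :=
  odflt ord0 [pick l | l \notin labels x].

Lemma fanoP (x : omega240) : exists2 f : 'rV['F_2]_3 -> 'I_8, injective f &
  triples x = [set f @: L | L : {set 'rV['F_2]_3} in pg22_lines].
Proof.
case: x => x /= /existsP[f /andP[/injectiveP fI /eqP ->]].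
by exists f.
Qed.

Lemma is_labelled_fanoI (f : 'rV['F_2]_3 -> 'I_8) : injective f ->
  is_labelled_fano [set f @: L | L : {set 'rV['F_2]_3} in pg22_lines].
Proof.
move=> fI; apply/existsP; exists [ffun u => f u]; apply/andP; split.
  by apply/injectiveP => u v; rewrite !ffunE; apply: fI.
apply/eqP; apply: eq_imset => L; apply: eq_imset => u; by rewrite ffunE.
Qed.

(* Action of S_8 on labels. In MathComp (s * t)%g applies s first, so this is
   an action in the sense of action.v. *)
Lemma act_subproof (x : omega240) (w : 'S_8) :
  is_labelled_fano [set w @: A | A : {set 'I_8} in triples x].
Proof.
have [f fI ->] := fanoP x.
have := is_labelled_fanoI (inj_comp (@perm_inj _ w) fI).
congr is_labelled_fano; rewrite -imset_comp; apply: eq_imset => L /=.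
by rewrite -imset_comp.
Qed.

Definition omega_act (x : omega240) (w : 'S_8) : omega240 :=
  Omega240 (act_subproof x w).

Lemma omega_act1 x : omega_act x 1 = x.
Proof.
apply: val_inj => /=; rewrite -[RHS]imset_id; apply: eq_imset => A.
by rewrite -[RHS]imset_id; apply: eq_imset => i; rewrite perm1.
Qed.

Lemma omega_actM x : act_morph omega_act x.
Proof.
move=> v w; apply: val_inj => /=; rewrite -imset_comp.
apply: eq_imset => A /=; rewrite -imset_comp.
by apply: eq_imset => i /=; rewrite permM.
Qed.

Definition omega_action : {action 'S_8 &-> omega240} :=
  TotalAction omega_act1 omega_actM.

Lemma card_rV23 : #|{: 'rV['F_2]_3}| = 8.
Proof. by rewrite card_mx card_Fp. Qed.

Lemma fano_trans (x y : omega240) : exists w, omega_act x w = y.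
Proof.
have [f fI xE] := fanoP x; have [g gI yE] := fanoP y.
have [f' fK f'K] : bijective f.
  by apply: inj_card_bij => //; rewrite card_rV23 card_ord.
have wI : injective (g \o f') by apply: inj_comp gI (can_inj f'K).
exists (perm wI); apply: val_inj; rewrite /= xE yE -imset_comp.
apply: eq_imset => L /=; rewrite -imset_comp; apply: eq_imset => u /=.
by rewrite permE /= fK.
Qed.

Definition simple_transp (i : 'I_7) : 'S_8 := tperm (inord i) (inord i.+1).

Definition is_word_length (w : 'S_8) (n : nat) : bool :=
  [exists c : n.-tuple 'I_7, w == (\prod_(i <- c) simple_transp i)%g].

Lemma simple_transp_gen :
  <<[set simple_transp i | i : 'I_7]>>%g = [set: 'S_8].
Proof.
apply/eqP; rewrite eqEsubset subsetT /= -(gen_tperm ord0) gen_subG.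
apply/subsetP => s /imsetP[/= [i ilt] _ ->].
have {ilt} -> : Ordinal ilt = inord i by apply: val_inj; rewrite /= inordK.
elim: i => [|i IHi].
  by rewrite [inord 0](_ : _ = ord0) ?tperm1 ?group1//; apply: val_inj; rewrite /= inordK.
have [ile|ilt] := leqP 7 i; last first.
  have [->|i0] := posnP i.
    rewrite [tperm _ _](_ : _ = simple_transp ord0).
      by rewrite mem_gen ?imset_f.
    congr tperm; apply: val_inj; by rewrite /= ?inordK.
  have -> : tperm ord0 (inord i.+1) =
      (tperm ord0 (inord i) ^ simple_transp (Ordinal ilt))%g :> 'S_8.
    rewrite tpermJ /simple_transp /= tpermL tpermD //.
      by rewrite -val_eqE /= inordK ?gtn_eqF// ltnW // ltnS.
    by rewrite -val_eqE /= inordK.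
  by rewrite groupJ // mem_gen ?imset_f.
rewrite /inord /insubd insubN ?tperm1 ?group1 //.
by rewrite -leqNgt ltnS.
Qed.

Lemma word_length_ex (w : 'S_8) : exists n, is_word_length w n.
Proof.
have : w \in <<[set simple_transp i | i : 'I_7]>>%g.
  by rewrite simple_transp_gen inE.
move=> /gen_prodgP[n [c cP ->]]; exists n; apply/existsP.
have cP' i : exists j, c i == simple_transp j.
  by have /imsetP[j _ ->] := cP i; exists j.
exists [tuple xchoose (cP' i) | i < n]; apply/eqP.
rewrite big_tuple; apply: eq_bigr => i _; rewrite tnth_mktuple.
exact/eqP/(xchooseP (cP' i)).
Qed.

Definition perm_length (w : 'S_8) : nat := ex_minn (word_length_ex w).

Definition vec3 (a b c : bool) : 'rV['F_2]_3 :=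
  (\row_(i < 3) (nth false [:: a; b; c] i)%:R)%R.

Lemma vec3_surj (u : 'rV['F_2]_3) :
  u = vec3 (u ord0 (inord 0) != 0%R) (u ord0 (inord 1) != 0%R)
           (u ord0 (inord 2) != 0%R).
Proof.
have F2E (z : 'F_2) : z = ((z != 0)%:R)%R by case: z => [[|[|]]] // ?; apply: val_inj.
apply/rowP => i; rewrite mxE [LHS]F2E; congr (nat_of_bool _)%:R%R.
by case: i => [[|[|[|]]]] // ?; congr (u _ _ != _); apply: val_inj;
  rewrite /= inordK.
Qed.

Lemma vec3_coord a b c :
  (((vec3 a b c ord0 (inord 0) != 0)%R = a) *
   ((vec3 a b c ord0 (inord 1) != 0)%R = b) *
   ((vec3 a b c ord0 (inord 2) != 0)%R = c))%type.
Proof. by rewrite !mxE !inordK //=; case: a b c => [] [] []. Qed.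

Lemma vec3D a b c a' b' c' :
  (vec3 a b c + vec3 a' b' c')%R = vec3 (a (+) a') (b (+) b') (c (+) c').
Proof.
apply/rowP => -[[|[|[|]]]] // ?; rewrite !mxE /=.
- by case: a a' => [] []; apply: val_inj.
- by case: b b' => [] []; apply: val_inj.
- by case: c c' => [] []; apply: val_inj.
Qed.

Definition dot3 (g : bool -> bool -> bool -> 'I_8) (p q : bool * bool * bool) :=
  [set g p.1.1 p.1.2 p.2; g q.1.1 q.1.2 q.2;
       g (p.1.1 (+) q.1.1) (p.1.2 (+) q.1.2) (p.2 (+) q.2)].

Lemma vec3_eq0 a b c : (vec3 a b c == 0)%R = ~~ [|| a, b | c].
Proof.
apply/eqP/idP => [e|].
  have := vec3_coord a b c; rewrite e !mxE eqxx => -[[<- <-] <-] //.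
case: a => //; case: b => //; case: c => // _.
by apply/rowP => -[[|[|[|]]]] // ?; rewrite !mxE /=; apply: val_inj.
Qed.

Lemma is_labelled_fano_bool (g : bool -> bool -> bool -> 'I_8)
    (x : {set {set 'I_8}}) :
  injective (fun p : bool * bool * bool => g p.1.1 p.1.2 p.2) ->
  (forall A, A \in x -> exists p q,
     [/\ p != (false, false, false), q != (false, false, false), p != q
       & A = dot3 g p q]) ->
  (forall p q, p != (false, false, false) -> q != (false, false, false) ->
     p != q -> dot3 g p q \in x) ->
  is_labelled_fano x.
Proof.
move=> gI xP xQ.
pose f (u : 'rV['F_2]_3) := g (u ord0 (inord 0) != 0%R)
  (u ord0 (inord 1) != 0%R) (u ord0 (inord 2) != 0%R).
have fE a b c : f (vec3 a b c) = g a b c by rewrite /f !vec3_coord.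
have fI : injective f.
  by move=> u v; rewrite (vec3_surj u) (vec3_surj v) !fE => /(gI (_,_,_) (_,_,_)) [-> -> ->].
have -> : x = [set f @: L | L : {set 'rV['F_2]_3} in pg22_lines];
  last exact: is_labelled_fanoI.
have fL u v w : f @: [set u; v; w] = [set f u; f v; f w].
  by rewrite !imsetU !imset_set1.
have vn (p q : bool * bool * bool) : p != q ->
    vec3 p.1.1 p.1.2 p.2 != vec3 q.1.1 q.1.2 q.2.
  apply: contra_neq => e; move: p q e => [[a b] c] [[a' b'] c'] /= e.
  have := vec3_coord a b c; rewrite e !vec3_coord => -[[-> ->] ->] //.
apply/setP=> A; apply/idP/imsetP => [/xP[p [q [p0 q0 pq ->]]]|[L]].
  exists [set vec3 p.1.1 p.1.2 p.2; vec3 q.1.1 q.1.2 q.2;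
    (vec3 p.1.1 p.1.2 p.2 + vec3 q.1.1 q.1.2 q.2)%R]; last first.
    by rewrite fL vec3D !fE.
  rewrite inE; apply/existsP; exists (vec3 p.1.1 p.1.2 p.2).
  apply/existsP; exists (vec3 q.1.1 q.1.2 q.2).
  rewrite eqxx (vn _ _ pq) !vec3_eq0.
  by case: p p0 {pq} => [[[] []] []] //; case: q q0 => [[[] []] []] //.
rewrite inE => /existsP[u] /existsP[v] /and4P[].
have [a [b [c ->]]] : exists a b c, u = vec3 a b c.
  by do 3!eexists; apply: vec3_surj.
have [a' [b' [c' ->]]] : exists a b c, v = vec3 a b c.
  by do 3!eexists; apply: vec3_surj.
rewrite !vec3_eq0 !negbK => p0 q0 pq /eqP -> ->; rewrite fL vec3D !fE.
apply: (xQ (a, b, c) (a', b', c')).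
- by move: p0; apply: contraTneq => -[-> -> ->].
- by move: q0; apply: contraTneq => -[-> -> ->].
- by apply: contra_neq pq => -[-> -> ->].
Qed.

Definition x0_triples : {set {set 'I_8}} :=
  [set tri 1 2 7; tri 1 3 6; tri 1 4 5; tri 2 3 5; tri 2 4 6; tri 3 4 7;
       tri 5 6 7].

Definition x1_triples : {set {set 'I_8}} :=
  [set tri 2 3 4; tri 2 5 6; tri 2 7 8; tri 3 5 7; tri 3 6 8; tri 4 5 8;
       tri 4 6 7].

Definition lab_of (s : seq nat) (a b c : bool) : 'I_8 := lb (nth 0 s (a + 2 * b + 4 * c)).

Lemma in_tri z i j k : 0 < i < 9 -> 0 < j < 9 -> 0 < k < 9 ->
  (z \in tri i j k) = [|| z.+1 == i, z.+1 == j | z.+1 == k].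
Proof.
case: i => // i; case: j => // j; case: k => // k /= hi hj hk.
by rewrite !inE -!val_eqE /= !inordK // !eqSS orbA.
Qed.

Lemma tri_eq i j k i' j' k' :
  [&& 0 < i < 9, 0 < j < 9, 0 < k < 9, 0 < i' < 9, 0 < j' < 9, 0 < k' < 9
    & perm_eq [:: i; j; k] [:: i'; j'; k']] -> (tri i j k == tri i' j' k').
Proof.
case/and5P=> hi hj hk hi' /and3P[hj' hk' /perm_mem e].
apply/eqP/setP => z; rewrite !in_tri //.
by have := e z.+1; rewrite !inE.
Qed.

Lemma lb_inj : {in [pred i | 0 < i < 9] &, injective lb}.
Proof.
move=> [|i] [|j] //; rewrite !inE /= => hi hj /(congr1 val) /=.
by rewrite !inordK //= => ->.
Qed.

Lemma x0_fano : is_labelled_fano x0_triples.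
Proof.
pose s := [:: 8; 1; 2; 7; 3; 6; 5; 4].
apply: (@is_labelled_fano_bool (lab_of s)).
- move=> [[a b] c] [[a' b'] c'] /lb_inj; rewrite !inE.
  by case: a b c a' b' c' => [] [] [] [] [] [] //= /(_ isT isT).
- move=> A; rewrite !inE -!orbA => /or4P[||| /or4P[|||]] /eqP ->.
  + exists (true, false, false), (false, true, false).
    by split=> //; apply/eqP; apply: tri_eq.
  + exists (true, false, false), (false, false, true).
    by split=> //; apply/eqP; apply: tri_eq.
  + exists (true, false, false), (true, true, true).
    by split=> //; apply/eqP; apply: tri_eq.
  + exists (false, true, false), (false, false, true).
    by split=> //; apply/eqP; apply: tri_eq.
  + exists (false, true, false), (true, true, true).
    by split=> //; apply/eqP; apply: tri_eq.
  + exists (false, false, true), (true, true, true).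
    by split=> //; apply/eqP; apply: tri_eq.
  + exists (false, true, true), (true, false, true).
    by split=> //; apply/eqP; apply: tri_eq.
- move=> [[a b] c] [[a' b'] c']; rewrite /dot3 /lab_of.
  case: a b c a' b' c' => [] [] [] [] [] [] // _ _ _ /=; rewrite !inE.
  all: by repeat (apply/orP; first [by right; apply: tri_eq | left]);
    apply: tri_eq.
Qed.

Lemma x1_fano : is_labelled_fano x1_triples.
Proof.
pose s := [:: 1; 2; 3; 4; 5; 6; 7; 8].
apply: (@is_labelled_fano_bool (lab_of s)).
- move=> [[a b] c] [[a' b'] c'] /lb_inj; rewrite !inE.
  by case: a b c a' b' c' => [] [] [] [] [] [] //= /(_ isT isT).
- move=> A; rewrite !inE -!orbA => /or4P[||| /or4P[|||]] /eqP ->.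
  + exists (true, false, false), (false, true, false).
    by split=> //; apply/eqP; apply: tri_eq.
  + exists (true, false, false), (false, false, true).
    by split=> //; apply/eqP; apply: tri_eq.
  + exists (true, false, false), (false, true, true).
    by split=> //; apply/eqP; apply: tri_eq.
  + exists (false, true, false), (false, false, true).
    by split=> //; apply/eqP; apply: tri_eq.
  + exists (false, true, false), (true, false, true).
    by split=> //; apply/eqP; apply: tri_eq.
  + exists (true, true, false), (false, false, true).
    by split=> //; apply/eqP; apply: tri_eq.
  + exists (true, true, false), (true, false, true).
    by split=> //; apply/eqP; apply: tri_eq.
- move=> [[a b] c] [[a' b'] c']; rewrite /dot3 /lab_of.
  case: a b c a' b' c' => [] [] [] [] [] [] // _ _ _ /=; rewrite !inE.
  all: by repeat (apply/orP; first [by right; apply: tri_eq | left]);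
    apply: tri_eq.
Qed.

Definition x0 : omega240 := Omega240 x0_fano.
Definition x1 : omega240 := Omega240 x1_fano.

Lemma height_ex (x : omega240) :
  exists n, [exists w : 'S_8, (omega_act x0 w == x) && (perm_length w == n)].
Proof.
have [w /eqP wx] := fano_trans x0 x.
by exists (perm_length w); apply/existsP; exists w; rewrite wx eqxx.
Qed.

Definition ht (x : omega240) : nat := ex_minn (height_ex x).

Lemma labelsE (x : omega240) (f : 'rV['F_2]_3 -> 'I_8) : injective f ->
  triples x = [set f @: L | L : {set 'rV['F_2]_3} in pg22_lines] ->
  labels x = [set~ f 0%R].
Proof.
move=> fI xE.
have [f' fK f'K] : bijective f.
  by apply: inj_card_bij => //; rewrite card_rV23 card_ord.
apply/setP => i; rewrite !inE /labels /cover xE.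
apply/bigcupP/idP => [[A /imsetP[L]]|].
  rewrite inE => /existsP[u] /existsP[v] /and4P[u0 v0 uv /eqP ->] ->.
  move=> /imsetP[w]; rewrite !inE -orbA => wP ->; rewrite (inj_eq fI).
  case/or3P: wP => /eqP -> //.
  rewrite addr_eq0; apply: contra_neq uv => ->.
  apply/rowP => j; rewrite mxE.
  by case: (v ord0 j) => [[|[|]]] // ?; apply: val_inj.
rewrite -{1 2}(f'K i) (inj_eq fI) => i0.
pose w : 'rV['F_2]_3 := (if f' i == delta_mx ord0 ord0 then delta_mx ord0 ord_max
   else delta_mx ord0 ord0)%R.
have w0 : w != 0%R.
  by rewrite /w; case: ifP => _; apply/eqP => /rowP;
    [move/(_ ord_max)|move/(_ ord0)]; rewrite !mxE.
have iw : f' i != w.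
  rewrite /w; case: ifPn => [/eqP ->|//]; apply/eqP => /rowP /(_ ord0).
  by rewrite !mxE.
exists (f @: [set f' i; w; (f' i + w)%R]); last first.
  by apply: imset_f; rewrite !inE eqxx.
apply: imset_f; rewrite inE; apply/existsP; exists (f' i).
by apply/existsP; exists w; rewrite i0 w0 iw eqxx.
Qed.

Lemma basepointE (x : omega240) (f : 'rV['F_2]_3 -> 'I_8) : injective f ->
  triples x = [set f @: L | L : {set 'rV['F_2]_3} in pg22_lines] ->
  basepoint x = f 0%R.
Proof.
move=> fI xE; rewrite /basepoint (labelsE fI xE).
case: pickP => [l|/(_ (f 0%R))] /=; rewrite !inE negbK; first by move/eqP.
by rewrite eqxx.
Qed.

Lemma basepointP (x : omega240) : labels x = [set~ basepoint x].
Proof.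
have [f fI xE] := fanoP x.
by rewrite (basepointE fI xE) (labelsE fI xE).
Qed.

(* a and b list the two other elements of the three triples {e, a i, b i}
   containing e, with a i < b i. *)
Definition is_star (x : omega240) (e : 'I_8) (a b : {ffun 'I_3 -> 'I_8}) : bool :=
  ([set A in triples x | e \in A] == [set [set e; a i; b i] | i : 'I_3])
  && [forall i, a i < b i].

(* f is the point of intersection of the line through p and q with the line
   through r and s. *)
Definition is_meet (x : omega240) (p q r s f : 'I_8) : bool :=
  [exists L in triples x, exists M in triples x,
     [&& p \in L, q \in L, r \in M, s \in M & L :&: M == [set f]]].

Definition i1 : 'I_3 := inord 0.
Definition i2 : 'I_3 := inord 1.
Definition i3 : 'I_3 := inord 2.

Definition odd_for (x : omega240) (a b : {ffun 'I_3 -> 'I_8}) : bool :=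
  ([set a i1; a i2; a i3] \in triples x)
  && is_meet x (a i1) (a i2) (b i1) (b i2) (a i3).

Definition even_for (x : omega240) (a b : {ffun 'I_3 -> 'I_8}) : bool :=
  ([set b i1; b i2; b i3] \in triples x)
  && is_meet x (a i1) (a i2) (b i1) (b i2) (b i3).

Definition odd_label (x : omega240) (e : 'I_8) : bool :=
  [exists a, exists b, is_star x e a b && odd_for x a b].

Definition even_label (x : omega240) (e : 'I_8) : bool :=
  [exists a, exists b, is_star x e a b && even_for x a b].

Definition num_odd (x : omega240) : nat := #|[set e in labels x | odd_label x e]|.

Definition h (x : omega240) : nat := num_odd x + (8 - label_value (basepoint x)).

Definition z0 : 'S_8 :=
  (tperm (lb 1) (lb 8) * tperm (lb 2) (lb 7) * tperm (lb 3) (lb 6)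
   * tperm (lb 4) (lb 5))%g.

Definition bruhat_step : rel omega240 := fun x y =>
  [exists i, exists j, [&& i != j, y == omega_act x (tperm i j) & ht x < ht y]].

(* connect is the reflexive transitive closure. *)
Definition bruhat_le : rel omega240 := connect bruhat_step.

(* Signed objects: (i, false) is i and (i, true) is i with its sign changed. *)
Definition signed_obj : finType := ('I_8 * bool)%type.

Definition bar (p : signed_obj) : signed_obj := (p.1, ~~ p.2).

(* The objects whose sign is changed by g. *)
Definition sign_changes (g : {perm signed_obj}) : {set 'I_8} :=
  [set i | (g (i, false)).2].

(* The signed permutations with evenly many sign changes. *)
Definition WD8 : {set {perm signed_obj}} :=
  [set g : {perm signed_obj} | [forall p, g (bar p) == bar (g p)]
           && ~~ odd #|sign_changes g|].

(* (i j): exchange i and j. *)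
Definition wd8_transp (i j : 'I_8) : {perm signed_obj} :=
  (tperm (i, false) (j, false) * tperm (i, true) (j, true))%g.

(* Exchange i and j and change the sign of each. *)
Definition wd8_signed_transp (i j : 'I_8) : {perm signed_obj} :=
  (tperm (i, false) (j, true) * tperm (i, true) (j, false))%g.

Definition is_reflection (r : {perm signed_obj}) : bool :=
  [exists i, exists j, (i != j) &&
     ((r == wd8_transp i j) || (r == wd8_signed_transp i j))].

Definition is_pure_sign_change (t : {perm signed_obj}) : bool :=
  (t \in WD8) && [forall i, t (i, false) \in [:: (i, false); (i, true)]].

(* V is F_2^8 modulo the line spanned by the all-ones vector; its elements are
   represented by cosets, that is, by sets of vectors. *)
Definition coset8 (v : 'rV['F_2]_8) : {set 'rV['F_2]_8} :=
  [set (v + c *: const_mx 1)%R | c : 'F_2].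

Definition vA (A : {set 'I_8}) : {set 'rV['F_2]_8} :=
  coset8 (\sum_(i in A) delta_mx ord0 i)%R.

Definition lambda_minus (x : omega240) : {set {set 'rV['F_2]_8}} :=
  vA [set basepoint x] |: [set vA A | A : {set 'I_8} in triples x].

(* g first changes signs, adding the i-th basis vector for each i in
   sign_changes g, and then permutes the objects. *)
Definition signed_act (v : 'rV['F_2]_8) (g : {perm signed_obj}) : 'rV['F_2]_8 :=
  (\sum_i (v ord0 i + (i \in sign_changes g)%:R)
            *: delta_mx ord0 (g (i, false)).1)%R.

(* Determined by lambda_minus_inj and lambda_minus_act below. *)
Definition wd8_act (x : omega240) (g : {perm signed_obj}) : omega240 :=
  odflt x [pick y | lambda_minus y ==
    [set [set signed_act v g | v in C] | C : {set 'rV['F_2]_8} in lambda_minus x]].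

Section SignedAct.

Local Open Scope ring_scope.

Lemma F2E (z : 'F_2) : z = (z != 0)%:R.
Proof. by case: z => [[|[|]]] // ?; apply: val_inj. Qed.

Lemma F2_addvv n (v : 'rV['F_2]_n) : v + v = 0.
Proof.
apply/rowP => j; rewrite !mxE.
by case: (v _ _) => [[|[|]]] // ?; apply: val_inj.
Qed.

Lemma F2_addv_eq0 n (u v : 'rV['F_2]_n) : (u + v == 0) = (u == v).
Proof.
rewrite addr_eq0; congr (_ == _); apply/eqP.
by rewrite -subr_eq0 -opprD F2_addvv oppr0.
Qed.

Lemma sum_rV23 : \sum_(u : 'rV['F_2]_3) u = 0.
Proof.
apply/rowP => j; rewrite summxE mxE.
pose k : 'I_3 := if j == ord0 then ord_max else ord0.
have kj : k != j by rewrite /k; case: ifP => [/eqP ->|/negbT]; rewrite // eq_sym.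
pose d : 'rV['F_2]_3 := delta_mx ord0 k.
rewrite (bigID (fun u : 'rV['F_2]_3 => u ord0 k == 0)) /=.
rewrite (reindex_inj (addIr d)) /=.
rewrite (eq_big (fun u : 'rV['F_2]_3 => u ord0 k != 0) (fun u => u ord0 j)).
- rewrite -mulr2n -mulr_natr.
  by rewrite (_ : 2%:R = 0 :> 'F_2) ?mulr0 //; apply: val_inj.
- move=> u; rewrite !mxE !eqxx /= (F2E (u ord0 k)).
  by case: (_ != 0).
- by move=> u _; rewrite !mxE eqxx /= eq_sym (negbTE kj) addr0.
Qed.

Definition wt (v : 'rV['F_2]_8) : 'F_2 := \sum_i v ord0 i.

Definition moment (f' : 'I_8 -> 'rV['F_2]_3) (v : 'rV['F_2]_8) : 'rV['F_2]_3 :=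
  \sum_i v ord0 i *: f' i.

Definition charv (A : {set 'I_8}) : 'rV['F_2]_8 := \sum_(i in A) delta_mx ord0 i.

Lemma charvE A i : charv A ord0 i = (i \in A)%:R.
Proof.
rewrite /charv summxE big_mkcond (bigD1 i) //= big1 ?addr0 => [|j ji].
  by case: ifP; rewrite ?mxE ?eqxx.
by rewrite mxE eq_sym (negbTE ji) if_same.
Qed.

Lemma charv_supp (v : 'rV['F_2]_8) : v = charv [set i | v ord0 i != 0].
Proof. by apply/rowP => i; rewrite charvE inE -F2E. Qed.

Lemma wt_charv A : wt (charv A) = #|A|%:R.
Proof.
rewrite /wt (eq_bigr (fun i => (i \in A)%:R)) => [|i _]; last by rewrite charvE.
by rewrite -natr_sum -sum1_card [in RHS]big_mkcond; congr (_%:R);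
  apply: eq_bigr => i _; case: (_ \in _).
Qed.

Lemma moment_charv f' A : moment f' (charv A) = \sum_(i in A) f' i.
Proof.
rewrite /moment [RHS]big_mkcond; apply: eq_bigr => i _; rewrite charvE.
by case: ifP; rewrite ?scale1r ?scale0r.
Qed.

Lemma charvC A : charv (~: A) = (charv A + const_mx 1)%R.
Proof.
apply/rowP => i; rewrite mxE !charvE mxE inE.
by case: (_ \in _); apply: val_inj.
Qed.

Lemma coset8_mem v w : (w \in coset8 v) = (w == v) || (w == v + const_mx 1).
Proof.
apply/imsetP/orP => [[c _ ->]|[]/eqP ->]; last 2 first.
- by exists 0; rewrite // scale0r addr0.
- by exists 1; rewrite // scale1r.
case: (F2E c) => ->; case: (c != 0); rewrite ?scale0r ?addr0 ?scale1r eqxx; auto.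
Qed.

Lemma coset8D v : coset8 (v + const_mx 1) = coset8 v.
Proof.
by apply/setP => w; rewrite !coset8_mem -addrA F2_addvv addr0 orbC.
Qed.

Lemma natrF2 n : (n%:R : 'F_2) = (odd n)%:R.
Proof.
rewrite -{1}(odd_double_half n) natrD -muln2 natrM.
by rewrite (_ : 2%:R = 0 :> 'F_2) ?mulr0 ?addr0 //; apply: val_inj.
Qed.

Lemma lambda_minusP (x : omega240) (f : 'rV['F_2]_3 -> 'I_8) f' C :
  cancel f f' -> cancel f' f ->
  triples x = [set f @: L | L : {set 'rV['F_2]_3} in pg22_lines] ->
  reflect (exists2 v, C = coset8 v & wt v = 1 /\ moment f' v = 0)
          (C \in lambda_minus x).
Proof.
move=> fK f'K xE; have fI := can_inj fK; have f'I := can_inj f'K.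
have m1 : moment f' (const_mx 1) = 0.
  rewrite /moment (reindex f); last by exists f' => u _; rewrite (fK, f'K).
  rewrite -[RHS]sum_rV23; apply: eq_bigr => u _.
  by rewrite mxE scale1r fK.
rewrite /lambda_minus (basepointE fI xE) !inE.
apply: (iffP orP) => [[/eqP ->|]|[v -> [v1 v0]]].
- exists (charv [set f 0]) => //; rewrite wt_charv cards1 moment_charv big_set1.
  by rewrite fK.
- rewrite xE => /imsetP[A /imsetP[L Ll ->] ->].
  exists (charv (f @: L)) => //; rewrite wt_charv card_imset // moment_charv.
  rewrite big_imset /=; last by move=> ? ? _ _; apply: fI.
  rewrite (eq_bigr id) => [|u _]; last by rewrite fK.
  move: Ll; rewrite inE => /existsP[u] /existsP[w] /and4P[u0 w0 uw /eqP ->].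
  have nL : u + w \notin [set u; w].
    by rewrite !inE -subr_eq0 addrAC subrr add0r -[_ == w]subr_eq0 addrK negb_or u0 w0.
  rewrite setUC (big_setU1 _ nL) cardsU1 nL cards2 uw.
  rewrite big_setU1 ?inE //= big_set1 F2_addvv; split=> //.
  exact: val_inj.
have [A [vE A1 A0 A4]] : exists A : {set 'I_8}, [/\ coset8 v = coset8 (charv A),
    odd #|A|, \sum_(i in A) f' i = 0 & (#|A| <= 4)%N].
  have [le4|gt4] := leqP #|[set i | v ord0 i != 0]| 4.
    exists [set i | v ord0 i != 0]; rewrite -moment_charv -charv_supp; split=> //.
    by move: v1; rewrite {1}(charv_supp v) wt_charv natrF2; case: odd.
  exists (~: [set i | v ord0 i != 0]).
  have cC := cardsC [set i | v ord0 i != 0].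
  rewrite card_ord in cC.
  rewrite -moment_charv charvC -charv_supp coset8D; split=> //.
  - move: v1; rewrite {1}(charv_supp v) wt_charv natrF2.
    by move/(congr1 odd): cC; rewrite oddD; case: odd => //=; case: odd.
  - rewrite /moment; under eq_bigr do rewrite mxE scalerDl.
    by rewrite big_split /= -/(moment _ _) v0 -/(moment f' (const_mx 1)) m1 addr0.
  - by rewrite leqNgt; apply/negP => /(leq_add gt4); rewrite cC.
rewrite vE => {v v1 v0 vE}.
have : #|A| = 1%N \/ #|A| = 3.
  by move: A1 A4; case: #|A| => [|[|[|[|[|]]]]]; auto.
case=> [/eqP/cards1P[i iE]|cA].
  move: A0; rewrite iE big_set1 => i0; left.
  by rewrite -i0 f'K.
right; have [i iA] : exists i, i \in A by apply/card_gt0P; rewrite cA.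
have := cardsD1 i A; rewrite iA cA => -[] /esym/eqP/cards2P[j [k [jk AE]]].
have {}AE : A = [set i; j; k] by rewrite -(setD1K iA) AE setUA.
have iN : i \notin [set j; k].
  by move: cA; rewrite AE -setUA cardsU1 cards2 jk; case: (_ \notin _).
move: A0; rewrite AE -setUA big_setU1 //= big_setU1 ?inE //= big_set1.
move/eqP; rewrite addrA F2_addv_eq0 => /eqP kE.
rewrite xE; apply/imsetP; exists (f @: [set f' i; f' j; f' k]); last first.
  by rewrite !imsetU !imset_set1 !f'K -setUA.
apply: imset_f; rewrite inE; apply/existsP; exists (f' i); apply/existsP.
exists (f' j); rewrite kE eqxx (inj_eq f'I).
move: iN; rewrite !inE negb_or => /andP[ij ik]; rewrite ij !andbT.
apply/andP; split; apply/eqP => e0; move: kE; rewrite e0.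
  by rewrite add0r => /f'I e; rewrite e eqxx in jk.
by rewrite addr0 => /f'I e; rewrite e eqxx in ik.
Qed.

Definition unsigned (g : {perm signed_obj}) (i : 'I_8) : 'I_8 := (g (i, false)).1.

Lemma WD8P (g : {perm signed_obj}) : g \in WD8 ->
  (forall p, g (bar p) = bar (g p)) /\ ~~ odd #|sign_changes g|.
Proof. by rewrite inE => /andP[/forallP gb ->]; split=> // p; apply/eqP. Qed.

Lemma unsigned_inj (g : {perm signed_obj}) :
  (forall p, g (bar p) = bar (g p)) -> injective (unsigned g).
Proof.
move=> gb i j; rewrite /unsigned => eij.
have [e2|ne2] := eqVneq (g (i, false)).2 (g (j, false)).2.
  suff /perm_inj [] : g (i, false) = g (j, false) by [].
  by rewrite (surjective_pairing (g (i, _))) eij e2 -surjective_pairing.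
suff /perm_inj : g (i, false) = g (j, true) by [].
rewrite (gb (j, false)) /bar -eij (surjective_pairing (g (i, _))) /=.
by congr pair; case: (g (i, _)).2 (g (j, _)).2 ne2 => [] [].
Qed.

Lemma signed_actE (g : {perm signed_obj}) v i :
  (forall p, g (bar p) = bar (g p)) ->
  signed_act v g ord0 (unsigned g i) = v ord0 i + (i \in sign_changes g)%:R.
Proof.
move=> gb; rewrite /signed_act summxE (bigD1 i) //= big1 ?addr0 => [|j ji].
  by rewrite !mxE !eqxx mulr1.
rewrite !mxE -/(unsigned g j) (inj_eq (unsigned_inj gb)).
by rewrite [i == j]eq_sym (negbTE ji) mulr0.
Qed.

Lemma signed_act_sign_change v i :
  signed_act v (tperm (i, false) (i, true)) = v + delta_mx ord0 i.
Proof.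
have gb p : tperm (i, false) (i, true) (bar p) = bar (tperm (i, false) (i, true) p).
  by case: p => j b; rewrite !permE /= !xpair_eqE /=; case: eqP b => [->|_] [].
apply/rowP => j.
have uj : unsigned (tperm (i, false) (i, true)) j = j.
  by rewrite /unsigned permE /= !xpair_eqE; case: eqP.
rewrite -[in LHS]uj signed_actE // !mxE eqxx /= inE permE /= !xpair_eqE andbT andbF.
by rewrite eq_sym; case: eqP.
Qed.

Lemma signed_act_unsigned v (w : 'S_8) (g : {perm signed_obj}) :
  (forall p, g p = (w p.1, p.2)) ->
  signed_act v g = \sum_i v ord0 i *: delta_mx ord0 (w i).
Proof.
move=> gE; apply: eq_bigr => i _; rewrite inE gE addr0 //.
Qed.

Lemma signed_actM v (g k : {perm signed_obj}) :
  (forall p, g (bar p) = bar (g p)) -> (forall p, k (bar p) = bar (k p)) ->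
  signed_act v (g * k) = signed_act (signed_act v g) k.
Proof.
move=> gb kb.
have gkb p : (g * k)%g (bar p) = bar ((g * k)%g p) by rewrite !permM gb kb.
have uM i : unsigned (g * k) i = unsigned k (unsigned g i).
  rewrite /unsigned permM; case: (g _) => j [] //=.
  by rewrite (kb (j, false)).
apply/rowP => j; have [w wK Kw] := injF_bij (unsigned_inj gkb).
rewrite -(Kw j) signed_actE // uM !signed_actE // -addrA; congr (_ + _).
rewrite !inE permM /unsigned; case: (g _) => l [] /=.
  by rewrite (kb (l, false)) /=; case: (k _).2; apply: val_inj.
by rewrite add0r.
Qed.

Lemma sum_sign_changes (g : {perm signed_obj}) : ~~ odd #|sign_changes g| ->
  \sum_i (i \in sign_changes g)%:R = 0 :> 'F_2.
Proof.
move=> ev; rewrite (_ : \sum_i _ = wt (charv (sign_changes g))).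
  by rewrite wt_charv natrF2 (negbTE ev).
by apply: eq_bigr => i _; rewrite charvE.
Qed.

Lemma group_set_WD8 : group_set WD8.
Proof.
have WE (g : {perm signed_obj}) : (forall p, g (bar p) = bar (g p)) ->
    (\sum_i (i \in sign_changes g)%:R = 0 :> 'F_2) -> g \in WD8.
  move=> gb g0; rewrite inE; apply/andP; split.
    by apply/forallP => p; apply/eqP.
  move: g0; rewrite (_ : \sum_i _ = wt (charv (sign_changes g))).
    by rewrite wt_charv natrF2; case: odd.
  by apply: eq_bigr => i _; rewrite charvE.
apply/group_setP; split.
  apply: WE => [p|]; first by rewrite !perm1.
  by rewrite big1 // => i _; rewrite inE perm1.
move=> g k /WD8P[gb /sum_sign_changes g0] /WD8P[kb /sum_sign_changes k0].
apply: WE => [p|]; first by rewrite !permM gb kb.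
rewrite (reindex_inj (unsigned_inj gb)) /= in k0.
rewrite -[RHS](addr0 0) -[X in _ = X + _]g0 -[X in _ = _ + X]k0.
rewrite -big_split; apply: eq_bigr => i _ /=.
rewrite !inE permM /unsigned; case: (g _) => l [] /=.
  by rewrite (kb (l, false)) /=; case: (k _).2; apply: val_inj.
by rewrite add0r.
Qed.

Canonical WD8_group := Group group_set_WD8.

Lemma wd8_transpE (i j : 'I_8) p : i != j ->
  wd8_transp i j p = (tperm i j p.1, p.2).
Proof.
move=> ij; have ji : j != i by rewrite eq_sym.
case: p => k b; rewrite /wd8_transp permM.
have ijE := (negbTE ij, negbTE ji, eqxx, andbF, andbT, xpair_eqE).
have [->|ki] := eqVneq k i.
  by case: b; do 4!rewrite ?permE ?ijE //=.
have [->|kj] := eqVneq k j.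
  by case: b; do 4!rewrite ?permE ?ijE //=.
have kE := (negbTE ki, negbTE kj, xpair_eqE).
by case: b; do 4!rewrite ?permE ?kE //=.
Qed.

Lemma wd8_signed_transpE (i j : 'I_8) p : i != j ->
  wd8_signed_transp i j p = (tperm i j p.1, p.2 (+) (p.1 \in [set i; j])).
Proof.
move=> ij; have ji : j != i by rewrite eq_sym.
case: p => k b; rewrite /wd8_signed_transp permM !inE.
have ijE := (negbTE ij, negbTE ji, eqxx, andbF, andbT, xpair_eqE).
have [->|ki] := eqVneq k i.
  by case: b; do 4!rewrite ?permE ?ijE //=.
have [->|kj] := eqVneq k j.
  by case: b; do 4!rewrite ?permE ?ijE //=.
have kE := (negbTE ki, negbTE kj, xpair_eqE).
by case: b; do 4!rewrite ?permE ?kE //=.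
Qed.

Lemma is_reflection_WD8 r : is_reflection r -> r \in WD8.
Proof.
move=> /existsP[i] /existsP[j] /andP[ij /orP[]/eqP ->]; rewrite inE.
  apply/andP; split; first by apply/forallP => p; rewrite !wd8_transpE //.
  rewrite (_ : sign_changes _ = set0) ?cards0 //.
  by apply/setP => k; rewrite !inE wd8_transpE //.
apply/andP; split.
  by apply/forallP => p; rewrite !wd8_signed_transpE // /bar /= addNb.
rewrite (_ : sign_changes _ = [set i; j]) ?cards2 ?ij //.
by apply/setP => k; rewrite !inE wd8_signed_transpE // !inE.
Qed.

Lemma lambda_minus_act_ex (x : omega240) (g : {perm signed_obj}) : g \in WD8 ->
  exists y : omega240, lambda_minus y ==
    [set [set signed_act v g | v in C] | C : {set 'rV['F_2]_8} in lambda_minus x].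
Proof.
move=> /WD8P[gb /sum_sign_changes s0].
have [f fI xE] := fanoP x.
have [f' fK f'K] : bijective f.
  by apply: inj_card_bij => //; rewrite card_rV23 card_ord.
have uI := unsigned_inj gb; have [w wK Kw] := injF_bij uI.
pose c := \sum_i (i \in sign_changes g)%:R *: f' i.
pose f2 u := unsigned g (f (u + c)); pose f2' i := f' (w i) + c.
have f2K : cancel f2 f2' by move=> u; rewrite /f2' /f2 wK fK -addrA F2_addvv addr0.
have f2'K : cancel f2' f2 by move=> i; rewrite /f2' /f2 -addrA F2_addvv addr0 f'K Kw.
exists (Omega240 (is_labelled_fanoI (can_inj f2K))); apply/eqP.
have wtE v : wt (signed_act v g) = wt v.
  rewrite /wt (reindex_inj uI) /= -[RHS]addr0 -[X in _ = _ + X]s0 -big_split.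
  by apply: eq_bigr => i _; rewrite signed_actE.
have mE v : moment f2' (signed_act v g) = moment f' v + c + wt v *: c.
  have -> : wt v = \sum_i (v ord0 i + (i \in sign_changes g)%:R).
    by rewrite big_split /= s0 addr0.
  rewrite /moment (reindex_inj uI) /= scaler_suml /c -!big_split /=.
  apply: eq_bigr => i _; rewrite signed_actE // /f2' wK scalerDr.
  by rewrite [in LHS]scalerDl.
have coE v : [set signed_act u g | u in coset8 v] = coset8 (signed_act v g).
  have aE : signed_act (v + const_mx 1) g = signed_act v g + const_mx 1.
    apply/rowP => j; rewrite -(Kw j) signed_actE // [in RHS]mxE signed_actE //.
    by rewrite !mxE addrAC.
  apply/setP => u; rewrite coset8_mem; apply/imsetP/orP => [[t]|].
    by rewrite coset8_mem => /orP[]/eqP -> ->; rewrite ?aE eqxx; auto.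
  case=> /eqP ->; first by exists v; rewrite // coset8_mem eqxx.
  by exists (v + const_mx 1); rewrite ?aE // coset8_mem eqxx orbT.
have eqP2 v : (wt v = 1 /\ moment f' v = 0) <->
    (wt (signed_act v g) = 1 /\ moment f2' (signed_act v g) = 0).
  rewrite wtE mE; split=> -[v1 m0]; split=> //; move: m0; rewrite v1 scale1r.
    by move=> ->; rewrite add0r F2_addvv.
  by rewrite -addrA F2_addvv addr0.
apply/setP => C; apply/(lambda_minusP _ f2K f2'K _)/imsetP => // [[v -> v01]|].
  pose u : 'rV['F_2]_8 := \row_i (v ord0 (unsigned g i) + (i \in sign_changes g)%:R).
  have uE : v = signed_act u g.
    apply/rowP => j; rewrite -(Kw j) signed_actE // mxE -addrA.
    by case: (_ \in _); rewrite (F2E (v _ _)); case: (_ != _); apply: val_inj.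
  exists (coset8 u); last by rewrite coE -uE.
  apply/(lambda_minusP _ fK f'K xE); exists u => //.
  by apply/eqP2; rewrite -uE.
case=> D /(lambda_minusP _ fK f'K xE)[v -> v01] ->.
by exists (signed_act v g); [exact: coE|apply/eqP2].
Qed.

Lemma lambda_minus_act (x : omega240) (g : {perm signed_obj}) : g \in WD8 ->
  lambda_minus (wd8_act x g) =
    [set [set signed_act v g | v in C] | C : {set 'rV['F_2]_8} in lambda_minus x].
Proof.
move=> gW; rewrite /wd8_act; case: pickP => [y /eqP //|no].
by have [y] := lambda_minus_act_ex x gW; rewrite no.
Qed.

Lemma charv_inj : injective charv.
Proof.
move=> A B e; apply/setP => i; move/rowP/(_ i): e; rewrite !charvE.
by case: (_ \in _); case: (_ \in _).
Qed.

Lemma vA_eq A B : vA A = vA B -> A = B \/ A = ~: B.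
Proof.
move=> /setP/(_ (charv A)); rewrite !coset8_mem eqxx /= => /esym.
rewrite -charvC !(inj_eq charv_inj) => /orP[]/eqP; auto.
Qed.

Lemma card_triple (x : omega240) A : A \in triples x -> #|A| = 3.
Proof.
have [f fI ->] := fanoP x => /imsetP[L].
rewrite inE => /existsP[u] /existsP[w] /and4P[u0 w0 uw /eqP ->] ->.
rewrite card_imset // setUC cardsU1 cards2 uw.
suff -> : u + w \notin [set u; w] by [].
by rewrite !inE -subr_eq0 addrAC subrr add0r -[_ == w]subr_eq0 addrK negb_or u0 w0.
Qed.

Lemma lambda_minus_inj : injective lambda_minus.
Proof.
move=> x y e; apply: val_inj; apply/setP => A /=.
have H z : (A \in triples z) = (#|A| == 3) && (vA A \in lambda_minus z).
  apply/idP/andP => [Az|[/eqP cA]].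
    by rewrite (card_triple Az) eqxx !inE imset_f // orbT.
  have cB (B : {set 'I_8}) : vA A = vA B -> A = B \/ #|B| = 5.
    move/vA_eq => [|AB]; first by left.
    right; have := cardsC B; rewrite -AB cA card_ord.
    by move=> /(congr1 (subn^~ 3)); rewrite /= addnK.
  rewrite !inE => /orP[/eqP/cB[e1|]|/imsetP[B Bz /cB[->//|]]].
  - by move: cA; rewrite e1 cards1.
  - by rewrite cards1.
  - by rewrite (card_triple Bz).
by rewrite !H e.
Qed.

End SignedAct.

(* Main.v *)
Require Import Defs.
From mathcomp Require Import all_boot all_order all_fingroup all_algebra all_solvable.
From mathcomp Require Import zify.

Set Implicit Arguments.
Unset Strict Implicit.
Unset Printing Implicit Defensive.

Import GRing.Theory.

(** A labelled Fano plane [x] is the image of the lines of [F_2^3] under a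
bijection [f] from [F_2^3] to the labels, and its basepoint is [f 0].  All
statements become statements about [f].

For [c != 0], the lines through the label [f c] are the pairs [{u, u + c}] with
[u] outside [{0, c}].  Let [lows f c] be the set of the three [u] that carry the
smaller label of their pair.  The lines are the triples of distinct nonzero
vectors with sum zero, and three vectors chosen one from each pair always have
sum [0] or [c] ([lowsumP]).  If the sum of [lows f c] is [0], the three smaller
labels form a line and [f c] is odd; if it is [c], replacing each [u] by [u + c]
changes the sum by [3c = c], so the three larger labels form a line and [f c] is
even ([star_parity]).  In both cases the third label on that line is also the
intersection point in the definition of parity, because
[(u + c) + (v + c) = u + v].

The simple transposition of [i] and [i+1] reverses the comparison of these two
labels and of no others.  If neither is the basepoint, at [p] and [q] say, they
form a pair only for [c = p + q], where [lows f c] exchanges [p] for [q]; its sum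
changes by [c], so exactly one parity changes.  If one of them is the basepoint,
no pair is affected and the basepoint moves by one.  This proves
[h (s x) = h x +- 1] ([h_simple_cases]).

As [h x0 = 0], the value [h x] is at most the length of any word leading from
[x0] to [x].  Conversely, a plane all of whose seven simple neighbours are higher
must be [x0] ([no_descent_x0]): its basepoint is [8], since moving the basepoint
up by one is a descent, and a finite check over the bijections with [f 0] equal
to the label [8] leaves only [x0].  Descending as long as possible therefore ends
in [x0] after [h x] steps, and [ht = h] ([ht_h]).

It also follows that [w] in [S_8] changes the parity of [h] by its sign, which
describes the orbits of [A_8].  An element [g] of [W(D_8)] with sign changes at a
set of labels acts on [f] by first translating [F_2^3] by the sum [c] of the
corresponding vectors, then permuting the labels by the unsigned part of [g]
([wd8_actE]).  A translation by [c != 0] is a product of four disjoint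
transpositions, so only the sign of the unsigned part counts.

Finally, [z0] reverses the order of the labels, so it replaces [lows f c] by its
translate by [c] and changes every parity, and it exchanges the basepoints [l]
and [9 - l].  Thus [h x + h (z0 x) = 14], and conjugation by [z0] reverses every
step of the Bruhat order. *)

(** * Coordinates on a labelled plane *)

Notation V := 'rV['F_2]_3.

(** The inverse [f'] is part of the data because pairs of labels are located by
their vectors throughout. *)
Definition coordinates (x : omega240) (f : V -> 'I_8) (f' : 'I_8 -> V) :=
  [/\ cancel f f', cancel f' f &
      triples x = [set f @: L | L : {set V} in pg22_lines]].

Lemma coordinates_ex x : exists f f', coordinates x f f'.
Proof.
have [f fI xE] := fanoP x.
have [f' fK f'K] : bijective f.
  by apply: inj_card_bij => //; rewrite card_rV23 card_ord.
by exists f, f'.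
Qed.

Lemma coordinates_act x f f' (w : 'S_8) : coordinates x f f' ->
  coordinates (omega_act x w) (w \o f) (f' \o w^-1)%g.
Proof.
move=> [fK f'K xE]; split.
- exact: can_comp (permK w) fK.
- exact: can_comp f'K (permKV w).
rewrite /= xE -imset_comp; apply: eq_imset => L /=.
by rewrite -imset_comp.
Qed.

Section Coordinates.

Local Open Scope ring_scope.

Lemma addvK (v : V) : cancel (+%R^~ v) (+%R^~ v).
Proof. by move=> u; rewrite -addrA F2_addvv addr0. Qed.

Lemma eq_addv (u v w : V) : (u + v == w) = (u == w + v).
Proof. by apply/eqP/eqP => [<-|->]; rewrite addvK. Qed.

Lemma sum_set3 (u v w : V) : v != w -> u \notin [set v; w] ->
  \sum_(t in [set u; v; w]) t = u + v + w.
Proof.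
by move=> vw uN; rewrite -setUA big_setU1 // big_setU1 ?inE //= big_set1 addrA.
Qed.

Lemma cards3_neq (T : finType) (u v w : T) :
  (#|[set u; v; w]| == 3) = (v != w) && (u \notin [set v; w]).
Proof.
by rewrite -setUA cardsU1 cards2; case: (v != w); case: (u \notin _).
Qed.

(** Membership of a listed triple is the sum condition in any order of listing.  A
set presented as a line has three elements, none of them zero, and sum zero, and
these properties do not depend on the presentation. *)
Lemma pg22_lineE (u v w : V) : ([set u; v; w] \in pg22_lines) =
  [&& u != 0, v != 0, u != v & w == u + v].
Proof.
rewrite inE; apply/idP/idP; last first.
  case/and4P=> u0 v0 uv /eqP ->.
  by apply/existsP; exists u; apply/existsP; exists v; rewrite u0 v0 uv eqxx.
case/existsP=> p /existsP[q /and4P[p0 q0 pq /eqP e]].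
have pqN : p \notin [set q; p + q].
  by rewrite !inE negb_or pq eq_sym addrC eq_addv F2_addvv q0.
have qN : q != p + q by rewrite eq_sym eq_addv F2_addvv.
have := cards3_neq u v w; rewrite e cards3_neq qN pqN => /esym/andP[vw uN].
have := sum_set3 qN pqN; rewrite -e sum_set3 // F2_addvv => /eqP.
rewrite F2_addv_eq0 eq_sym => ->; move: uN; rewrite !inE negb_or => /andP[-> _].
have: 0 \notin [set u; v; w] by rewrite e !inE !negb_or ![0 == _]eq_sym p0 q0 F2_addv_eq0 pq.
by rewrite !inE !negb_or ![0 == _]eq_sym -andbA => /and3P[-> ->].
Qed.

Variables (x : omega240) (f : V -> 'I_8) (f' : 'I_8 -> V).
Hypothesis xf : coordinates x f f'.

Lemma coord_inj : injective f. Proof. by have [/can_inj] := xf. Qed.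
Lemma coord_inv_inj : injective f'. Proof. by have [_ /can_inj] := xf. Qed.
Lemma coordK : cancel f f'. Proof. by have [] := xf. Qed.
Lemma coordVK : cancel f' f. Proof. by have [] := xf. Qed.

Lemma mem_triples u v w : ([set f u; f v; f w] \in triples x) =
  [&& u != 0, v != 0, u != v & w == u + v].
Proof.
have -> : [set f u; f v; f w] = f @: [set u; v; w].
  by rewrite !imsetU !imset_set1.
have [_ _ ->] := xf.
by rewrite (mem_imset _ _ (imset_inj coord_inj)) pg22_lineE.
Qed.

Lemma triplesP A : reflect
  (exists u v, [/\ u != 0, v != 0, u != v & A = [set f u; f v; f (u + v)]])
  (A \in triples x).
Proof.
apply: (iffP idP) => [|[u [v [u0 v0 uv ->]]]]; last by rewrite mem_triples u0 v0 uv eqxx.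
have [_ _ ->] := xf => /imsetP[L]; rewrite inE.
case/existsP=> u /existsP[v /and4P[u0 v0 uv /eqP -> ->]].
by exists u, v; rewrite !imsetU !imset_set1.
Qed.

Lemma labels_coord c : (f c \in labels x) = (c != 0).
Proof.
have [_ _ xE] := xf.
by rewrite (labelsE coord_inj xE) !inE (inj_eq coord_inj).
Qed.

Lemma basepoint_coord : basepoint x = f 0.
Proof. by have [_ _ xE] := xf; rewrite (basepointE coord_inj xE). Qed.

End Coordinates.

(** * The smaller labels of the pairs through a point *)

Section LowSum.

Local Open Scope ring_scope.

Implicit Types (f : V -> 'I_8) (c u v w : V).

Definition lows f c : {set V} :=
  [set u | [&& u != 0, u != c & (f u < f (u + c)%R)%N]].

Definition lowsum f c : V := \sum_(u in lows f c) u.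

Lemma lows_add f c u : injective f -> c != 0 -> u != 0 -> u != c ->
  (u + c \in lows f c) = (u \notin lows f c).
Proof.
move=> fI c0 u0 uc; rewrite !inE addvK u0 uc /= F2_addv_eq0 uc /=.
rewrite eq_addv F2_addvv u0 /= -leqNgt ltn_neqAle.
by rewrite (inj_eq val_inj) (inj_eq fI) eq_addv -{1}[u]addr0 (inj_eq (addrI _)) eq_sym c0.
Qed.

Lemma lows_setC f c : injective f -> c != 0 ->
  ~: [set 0; c] :\: lows f c = [set u + c | u in lows f c].
Proof.
move=> fI c0; apply/setP=> u; rewrite -{2}[u](addvK c) (mem_imset _ _ (can_inj (addvK c))).
rewrite in_setD in_setC in_set2 negb_or.
have [->|u0] := eqVneq u 0; first by rewrite andbF add0r inE eqxx andbF.
have [->|uc] := eqVneq u c; first by rewrite andbF F2_addvv inE eqxx.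
by rewrite lows_add // andbT.
Qed.

Lemma lows_sub f c : lows f c \subset ~: [set 0; c].
Proof.
by apply/subsetP=> u; rewrite !inE negb_or => /and3P[-> ->].
Qed.

Lemma card_lows f c : injective f -> c != 0 -> #|lows f c| = 3%N.
Proof.
move=> fI c0; have := cardsC [set 0; c].
rewrite cards2 eq_sym c0 card_rV23 -(cardsID (lows f c) (~: _)) (lows_setC fI c0).
rewrite (setIidPr (lows_sub f c)) card_imset; last exact: can_inj (addvK c).
by rewrite addnn /= => -[] /(congr1 half); rewrite doubleK.
Qed.

(** For distinct [u] and [v] in [lows f c], the vector [u + v] is not in [{0, c}], so
[u + v] or [u + v + c] is the third element of [lows f c]. *)
Lemma lowsumP f c : injective f -> c != 0 -> lowsum f c = 0 \/ lowsum f c = c.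
Proof.
move=> fI c0; have c3 := card_lows fI c0.
have lowsN u : u \in lows f c -> u != 0 /\ u != c by rewrite inE => /and3P[].
have [u ul] : exists u, u \in lows f c by apply/card_gt0P; rewrite c3.
have [v] : exists v, v \in lows f c :\ u.
  by apply/card_gt0P; move: c3; rewrite (cardsD1 u) ul add1n => -[->].
rewrite in_setD1 => /andP[vu vl].
have [[u0 uc] [v0 vc]] := (lowsN u ul, lowsN v vl).
have uv0 : u + v != 0 by rewrite F2_addv_eq0 eq_sym.
have uvc : u + v != c.
  rewrite addrC eq_addv addrC; apply: contraTneq vl => ->.
  by rewrite lows_add // ul.
have key w : w \in lows f c -> w != u -> w != v -> lowsum f c = u + v + w.
  move=> wl wu wv; have uN : u \notin [set v; w].
    by rewrite !inE ![u == _]eq_sym negb_or vu wu.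
  have -> : lowsum f c = \sum_(t in [set u; v; w]) t.
    rewrite /lowsum; suff -> : lows f c = [set u; v; w] by [].
    apply/esym/eqP; rewrite eqEcard c3.
    have /eqP -> : #|[set u; v; w]| == 3%N by rewrite cards3_neq eq_sym wv.
    rewrite leqnn andbT; apply/subsetP=> t.
    by rewrite 2!in_setU !in_set1 -orbA => /or3P[]/eqP ->.
  by rewrite sum_set3 // eq_sym.
have [uvl|uvN] := boolP (u + v \in lows f c).
  left; rewrite (key _ uvl) ?F2_addvv //.
    by rewrite addrC eq_addv F2_addvv.
  by rewrite eq_addv F2_addvv.
right; have uvcl : u + v + c \in lows f c by rewrite lows_add.
rewrite (key _ uvcl) 1?(addrA (u + v)) ?F2_addvv ?add0r //.
  by rewrite -addrA addrC eq_addv F2_addvv F2_addv_eq0.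
by rewrite addrAC eq_addv F2_addvv F2_addv_eq0.
Qed.

End LowSum.

(** * Parity of labels as a sum of vectors *)

Section Parity.

Local Open Scope ring_scope.

Definition odd_points (f : V -> 'I_8) : {set V} :=
  [set c | (c != 0) && (lowsum f c == 0)].

Variables (x : omega240) (f : V -> 'I_8) (f' : 'I_8 -> V).
Hypothesis xf : coordinates x f f'.
Let fI := coord_inj xf.

Lemma star_pair c (a b : {ffun 'I_3 -> 'I_8}) i : is_star x (f c) a b ->
  f' (a i) \in lows f c /\ f' (b i) = f' (a i) + c.
Proof.
case/andP=> /eqP sE /forallP/(_ i) ab.
have : [set f c; a i; b i] \in [set A in triples x | f c \in A].
  by rewrite sE; apply: imset_f.
rewrite inE -[in X in X -> _](coordVK xf (a i)) -[in X in X -> _](coordVK xf (b i)).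
rewrite (mem_triples xf) => /andP[/and4P[c0 a0 ca /eqP bE] _].
have {}bE : f' (b i) = f' (a i) + c by rewrite bE addrC.
by split=> //; rewrite inE a0 eq_sym ca -bE !(coordVK xf).
Qed.

(** Any enumeration of the lines through a label has the same set of smaller
labels; this is what makes parity independent of the enumeration. *)
Lemma star_lows c a b : c != 0 -> is_star x (f c) a b ->
  lows f c = [set f' (a i) | i : 'I_3].
Proof.
move=> c0 st; have abP i := star_pair i st.
apply/setP=> u; apply/idP/imsetP=> [ul|[i _ ->]]; last by have [] := abP i.
have := ul; rewrite inE => /and3P[u0 uc _].
have : [set f c; f u; f (u + c)] \in [set A in triples x | f c \in A].
  by rewrite inE (mem_triples xf) c0 u0 eq_sym uc addrC eqxx !inE eqxx.
case/andP: (st) => /eqP -> _ /imsetP[i _ e]; exists i => //.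
have [al bE] := abP i; have : f u \in [set f c; a i; b i] by rewrite -e !inE eqxx orbT.
rewrite !inE (inj_eq fI) (negbTE uc) /= => /orP[/eqP <-|/eqP ub].
  by rewrite (coordK xf).
move: ul; rewrite -[u](coordK xf) ub bE lows_add ?al //.
  by move: al; rewrite inE => /and3P[].
by move: al; rewrite inE => /and3P[].
Qed.

Lemma star_ex c : c != 0 -> exists a b, is_star x (f c) a b.
Proof.
move=> c0; have c3 := card_lows fI c0.
pose u (i : 'I_3) := enum_val (cast_ord (esym c3) i).
have ul i : u i \in lows f c by apply: enum_valP.
exists [ffun i => f (u i)], [ffun i => f (u i + c)]; apply/andP; split; last first.
  by apply/forallP=> i; rewrite !ffunE; move: (ul i); rewrite inE => /and3P[].
apply/eqP/setP=> A; rewrite inE; apply/idP/imsetP=> [|[i _ ->]]; last first.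
  rewrite !ffunE (mem_triples xf) c0 addrC eqxx !inE eqxx /=.
  by move: (ul i); rewrite inE => /and3P[-> uc _]; rewrite eq_sym uc.
case/andP=> /(triplesP xf) [v [w [v0 w0 vw AE]]] cA.
(* Whichever of the three points of the line is c, the other two are t, t + c. *)
have [t [t0 ct {}AE]] : exists t, [/\ t != 0, t != c & A = [set f c; f t; f (t + c)]].
  move: cA; rewrite AE !inE !(inj_eq fI) -orbA => /or3P[]/eqP ->.
  - by exists w; rewrite w0 eq_sym vw addrC.
  - by exists v; rewrite v0 vw [[set f w; f v]]setUC.
  - exists v; split=> //; first by rewrite eq_sym addrC eq_addv F2_addvv.
    by rewrite [v + w]addrC addrCA F2_addvv addr0 setUC setUA addrC.
have [tl|tN] := boolP (t \in lows f c).
  exists (cast_ord c3 (enum_rank_in tl t)) => //; rewrite !ffunE /u cast_ordK.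
  by rewrite enum_rankK_in.
have tl : t + c \in lows f c by rewrite lows_add.
exists (cast_ord c3 (enum_rank_in tl (t + c))) => //; rewrite !ffunE /u cast_ordK.
by rewrite enum_rankK_in // addvK AE setUAC.
Qed.

(** The common third point of two lines [{p, q, t}] and [{r, s, t}]; the condition
on [r] keeps the lines distinct. *)
Lemma is_meet_coord p q r s : p != 0 -> q != 0 -> p != q -> r != 0 -> s != 0 ->
  r + s = p + q -> r \notin [set p; q] -> is_meet x (f p) (f q) (f r) (f s) (f (p + q)).
Proof.
move=> p0 q0 pq r0 s0 rs rN; have rsN : r != s by rewrite -F2_addv_eq0 rs F2_addv_eq0.
apply/exists_inP; exists [set f p; f q; f (p + q)].
  by rewrite (mem_triples xf) p0 q0 pq eqxx.
apply/exists_inP; exists [set f r; f s; f (p + q)].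
  by rewrite (mem_triples xf) r0 s0 rsN rs eqxx.
rewrite !inE !eqxx ?orbT /=; apply/eqP/setP=> e.
rewrite -[e](coordVK xf); move: (f' e) => {e}e; rewrite !inE !(inj_eq fI).
have [->|eN] := eqVneq e (p + q); first by rewrite !orbT.
rewrite !orbF; apply/negP=> /andP[/orP[]/eqP -> /orP[]/eqP eE];
  move: rN; rewrite !inE -?eE ?eqxx ?orbT //.
- by move: rs; rewrite -eE addrC => /addrI ->; rewrite eqxx orbT.
- by move: rs; rewrite -eE => /addIr ->; rewrite eqxx.
Qed.

(** Three vectors with sum [0] form a line; the smaller labels have the vectors of
[lows f c], the larger ones have the translates of these by [c]. *)
Lemma star_parity c a b : c != 0 -> is_star x (f c) a b ->
  odd_for x a b = (lowsum f c == 0) /\ even_for x a b = (lowsum f c == c).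
Proof.
move=> c0 st; have abP i := star_pair i st.
have lE := star_lows c0 st.
pose u i := f' (a i); have uL i : u i \in lows f c by case: (abP i).
have uE i : f (u i) = a i by rewrite /u (coordVK xf).
have vE i : f (u i + c) = b i by case: (abP i) => _ <-; rewrite (coordVK xf).
have uN i : [/\ u i != 0, u i != c, u i + c != 0 & u i + c != c].
  have := uL i; rewrite inE => /and3P[u0 uc _]; split=> //.
    by rewrite F2_addv_eq0.
  by rewrite eq_addv F2_addvv.
have uI : injective u.
  have /imset_injP H : #|u @: 'I_3| == #|'I_3|.
    by rewrite -lE (card_lows fI c0) card_ord.
  by move=> i j; apply: H.
have sE : lowsum f c = u i1 + u i2 + u i3.
  rewrite /lowsum lE big_imset /=; last by move=> i j _ _; apply: uI.
  rewrite !big_ord_recl big_ord0 addr0 addrA.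
  by congr (_ + _ + _); congr u; apply: val_inj; rewrite /= inordK.
have u12 : u i1 != u i2 by rewrite (inj_eq uI) -val_eqE /= !inordK.
rewrite /odd_for /even_for -!uE -!vE !(mem_triples xf).
have [u10 _ v10 _] := uN i1; have [u20 _ v20 _] := uN i2.
have v12 : u i1 + c != u i2 + c by rewrite (inj_eq (addIr c)).
have vv : u i1 + c + (u i2 + c) = u i1 + u i2 by rewrite addrACA F2_addvv addr0.
(* The smaller labels u1, u2 and the larger labels u1 + c, u2 + c span lines with
   the same third point, whichever the parity. *)
have meet : is_meet x (f (u i1)) (f (u i2)) (f (u i1 + c)) (f (u i2 + c)) (f (u i1 + u i2)).
  apply: is_meet_coord => //; apply/negP => /set2P[/eqP|v1u2].
    by rewrite addrC eq_addv F2_addvv (negbTE c0).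
  move: (uL i2); rewrite -v1u2 lows_add ?uL //; by case: (uN i1).
have -> : (lowsum f c == 0) = (u i3 == u i1 + u i2).
  by rewrite sE F2_addv_eq0 eq_sym.
have -> : (lowsum f c == c) = (u i3 + c == u i1 + u i2).
  by rewrite sE (eq_addv _ (u i3)) [LHS]eq_sym [c + _]addrC.
rewrite u10 u20 v10 v20 u12 v12 vv.
by split; case: eqP => // ->; rewrite meet.
Qed.

Lemma odd_labelE c : c != 0 -> odd_label x (f c) = (lowsum f c == 0).
Proof.
move=> c0; apply/existsP/idP=> [[a /existsP[b /andP[st]]]|e0].
  by case: (star_parity c0 st) => ->.
have [a [b st]] := star_ex c0; exists a; apply/existsP; exists b.
by rewrite st; case: (star_parity c0 st) => ->.
Qed.

Lemma even_labelE c : c != 0 -> even_label x (f c) = (lowsum f c == c).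
Proof.
move=> c0; apply/existsP/idP=> [[a /existsP[b /andP[st]]]|e0].
  by case: (star_parity c0 st) => _ ->.
have [a [b st]] := star_ex c0; exists a; apply/existsP; exists b.
by rewrite st; case: (star_parity c0 st) => _ ->.
Qed.

Lemma h_coord : h x = (#|odd_points f| + (7 - f 0%R))%N.
Proof.
rewrite /h /label_value subSS (basepoint_coord xf); congr (_ + _)%N.
rewrite /num_odd -(card_imset _ fI); apply: eq_card => e.
rewrite -[e](coordVK xf); move: (f' e) => {e}c.
rewrite (mem_imset _ _ fI) !inE (labels_coord xf).
by have [//|c0] := eqVneq c 0; rewrite odd_labelE.
Qed.

End Parity.

(** * Simple reflections change the height function by one *)

Definition lo (i : 'I_7) : 'I_8 := inord i.
Definition hi (i : 'I_7) : 'I_8 := inord i.+1.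

Lemma val_lo i : lo i = i :> nat.
Proof. by rewrite inordK // (leq_trans (ltn_ord i)). Qed.

Lemma val_hi i : hi i = i.+1 :> nat.
Proof. by rewrite inordK // ltnS. Qed.

Lemma lo_neq_hi i : lo i != hi i.
Proof. by rewrite -val_eqE /= val_lo val_hi neq_ltn ltnSn. Qed.

Lemma simple_transp_ltn i (a b : 'I_8) :
  (simple_transp i a < simple_transp i b) =
  (a < b) (+) ((a == lo i) && (b == hi i) || (a == hi i) && (b == lo i)).
Proof.
have sE (e : 'I_8) : simple_transp i e = (if e == i :> nat then i.+1 else
    if e == i.+1 :> nat then i : nat else e) :> nat.
  rewrite /simple_transp -/(lo i) -/(hi i) permE /= -!val_eqE /= val_lo val_hi.
  by case: ifP => _; rewrite ?val_hi //; case: ifP => _; rewrite ?val_lo.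
rewrite !sE -!val_eqE /= val_lo val_hi.
move: (nat_of_ord a) (nat_of_ord b) (nat_of_ord i) => m n k {sE}.
by repeat case: eqP => ? /=; lia.
Qed.

Section SimpleReflection.

Local Open Scope ring_scope.

Variables (x : omega240) (f : V -> 'I_8) (f' : 'I_8 -> V).
Hypothesis xf : coordinates x f f'.
Let fI := coord_inj xf.
Variable i : 'I_7.
Let s := simple_transp i.
Let p := f' (lo i).
Let q := f' (hi i).

Lemma coord_pq : p != q.
Proof. by rewrite (inj_eq (coord_inv_inj xf)) lo_neq_hi. Qed.

Lemma coord_eqV u e : (f u == e) = (u == f' e).
Proof. by rewrite -{1}[e](coordVK xf) (inj_eq fI). Qed.

Lemma mem_lows_simple c u : (u \in lows (s \o f) c) =
  (u \in lows f c) (+) [&& u != 0, u != c & (c == p + q) && ((u == p) || (u == q))].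
Proof.
rewrite !inE /= simple_transp_ltn !coord_eqV -/p -/q ![u + c]addrC !eq_addv.
case: (u == 0) => //; case: (u == c) => //=; congr (_ (+) _).
have [->|_] := eqVneq u p; rewrite ?andbT ?andbF /=.
  by rewrite (negbTE coord_pq) orbF addrC.
by have [->|_] := eqVneq u q; rewrite ?andbT ?andbF.
Qed.

(** If [p] or [q] is zero, the pair [{p, q}] can only occur for [c = p + q], where
it is the excluded pair [{0, c}]. *)
Lemma lows_simple c : [|| p == 0, q == 0 | c != p + q] -> lows (s \o f) c = lows f c.
Proof.
move=> pqc; apply/setP=> u; rewrite mem_lows_simple.
suff /negbTE -> : ~~ [&& u != 0, u != c & (c == p + q) && ((u == p) || (u == q))].
  by rewrite addbF.
apply: contraL pqc => /and3P[u0 uc /andP[/eqP cE uE]]; move: u0 uc.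
rewrite cE eqxx; case/orP: uE => /eqP ->.
  by move=> /negbTE ->; apply: contraNN; rewrite orbF => /eqP ->; rewrite addr0.
by move=> /negbTE ->; rewrite orbF; apply: contraNN => /eqP ->; rewrite add0r.
Qed.

(** Since [p] carries [lo i] and [q] carries its successor [hi i], the set [lows]
contains [p] before the transposition and [q] after it. *)
Lemma lowsum_simple : p != 0 -> q != 0 ->
  lowsum (s \o f) (p + q) = lowsum f (p + q) + (p + q).
Proof.
move=> p0 q0.
have pc : p != p + q by rewrite eq_sym addrC eq_addv F2_addvv.
have qc : q != p + q by rewrite eq_sym eq_addv F2_addvv.
have pl : p \in lows f (p + q).
  by rewrite inE p0 pc addrA F2_addvv add0r !(coordVK xf) val_lo val_hi ltnSn.
have ql : q \in lows f (p + q) = false.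
  by rewrite inE q0 qc addrC addvK !(coordVK xf) val_lo val_hi ltnNge leqnSn.
have lE : lows (s \o f) (p + q) = q |: (lows f (p + q) :\ p).
  apply/setP=> u; rewrite mem_lows_simple in_setU1 in_setD1 eqxx /=.
  have [->|uq] := eqVneq u q; first by rewrite ql q0 qc orbT.
  have [->|up] := eqVneq u p; first by rewrite pl p0 pc.
  by rewrite !andbF addbF.
have sE : lowsum f (p + q) = p + \sum_(u in lows f (p + q) :\ p) u.
  by rewrite /lowsum (big_setD1 p).
rewrite sE /lowsum lE big_setU1 /=; last by rewrite in_setD1 ql andbF.
by rewrite [p + \sum_(_ in _) _]addrC addrA addvK addrC.
Qed.

(** The test decides whether [s] is a descent.  It is one if the basepoint moves up,
from [lo i] to [hi i], or if the third label on the line through [lo i] and [hi i]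
turns from odd to even. *)
Lemma h_simple_cases : let y := omega_act x s in
  if (p == 0) || (q != 0) && (lowsum f (p + q) == 0) then h x = (h y + 1)%N
  else h y = (h x + 1)%N.
Proof.
have sxf := coordinates_act s xf.
rewrite /= (h_coord xf) (h_coord sxf).
have [pq0|] := boolP ((p == 0) || (q == 0)).
  have -> : odd_points (s \o f) = odd_points f.
    by apply/setP=> c; rewrite !inE /lowsum lows_simple // orbA pq0.
  have pq := coord_pq; case/orP: pq0 => /eqP e; rewrite e eqxx /=.
    have -> : f 0 = lo i by rewrite -e (coordVK xf).
    by rewrite /s /simple_transp tpermL -/(lo i) -/(hi i) val_lo val_hi; have := ltn_ord i; lia.
  have -> : f 0 = hi i by rewrite -e (coordVK xf).
  have /negbTE -> : p != 0 by rewrite -e.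
  by rewrite /s /simple_transp tpermR -/(lo i) -/(hi i) val_lo val_hi /=; have := ltn_ord i; lia.
rewrite negb_or => /andP[p0 q0]; rewrite (negbTE p0) q0 /=.
have -> : (s (f 0) = f 0).
  by rewrite tpermD // eq_sym coord_eqV eq_sym.
have d0 : p + q != 0 by rewrite F2_addv_eq0 coord_pq.
have oE c : c \in odd_points (s \o f) = (c \in odd_points f) (+) (c == p + q).
  rewrite !inE; have [->|cd] := eqVneq c (p + q).
    rewrite lowsum_simple // d0 F2_addv_eq0 /=.
    by have [->|->] := lowsumP fI d0; rewrite eqxx ?(negbTE d0) // eq_sym (negbTE d0).
  by rewrite addbF /lowsum lows_simple // cd !orbT.
rewrite (cardsD1 (p + q) (odd_points (s \o f))) (cardsD1 (p + q) (odd_points f)) oE eqxx.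
have -> : odd_points (s \o f) :\ (p + q) = odd_points f :\ (p + q).
  by apply/setP=> c; rewrite !in_setD1 oE; case: eqP => //; rewrite addbF.
rewrite inE d0 /=; have [_|_] := eqVneq (lowsum f (p + q)) 0 => /=.
  by rewrite add0n add1n addSn addn1.
by rewrite add0n add1n addSn addn1.
Qed.

End SimpleReflection.

Lemma h_simple x (i : 'I_7) :
  h (omega_act x (simple_transp i)) = h x + 1 \/
  h x = h (omega_act x (simple_transp i)) + 1.
Proof.
have [f [f' xf]] := coordinates_ex x.
by have := h_simple_cases xf i => /=; case: ifP => _; auto.
Qed.

(** * The order-reversing permutation *)

Lemma z0E i : z0 i = rev_ord i.
Proof.
have tE k l (e : 'I_8) : k < 8 -> l < 8 -> tperm (inord k) (inord l) e =
    (if e == k :> nat then l else if e == l :> nat then k else e) :> nat.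
  move=> k8 l8; rewrite permE /= -!val_eqE /= !inordK //.
  by case: ifP => _; rewrite ?inordK //; case: ifP => _; rewrite ?inordK.
apply: val_inj; rewrite /z0 !permM /lb /= !tE //.
by case: i => [[|[|[|[|[|[|[|[|]]]]]]]]].
Qed.

Section Reversal.

Local Open Scope ring_scope.

Variables (f : V -> 'I_8) (c : V).
Hypotheses (fI : injective f) (c0 : c != 0).

Lemma lows_z0 : lows (z0 \o f) c = [set u + c | u in lows f c].
Proof.
rewrite -lows_setC //; apply/setP=> u.
rewrite in_setD in_setC in_set2 negb_or 2!inE /= !z0E /=.
case: (u == 0) => //=; case: (u == c) => //=; rewrite andbT -leqNgt.
have : f u != f (u + c) by rewrite (inj_eq fI) eq_sym addrC -subr_eq0 addrK.
rewrite -val_eqE /=; have := ltn_ord (f u); have := ltn_ord (f (u + c)).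
by move: (nat_of_ord (f u)) (nat_of_ord _) => m n; lia.
Qed.

(** The sum changes by [c] once for each of the three elements, that is by [c]. *)
Lemma lowsum_z0 : lowsum (z0 \o f) c = lowsum f c + c.
Proof.
rewrite /lowsum lows_z0 big_imset /=; last by move=> u v _ _ /addIr.
by rewrite big_split /= sumr_const card_lows // mulrS mulr2n F2_addvv addr0.
Qed.

End Reversal.

Lemma card_odd_points_z0 f : injective f ->
  #|odd_points (z0 \o f)| + #|odd_points f| = 7.
Proof.
move=> fI.
have -> : odd_points (z0 \o f) = [set~ 0%R] :\: odd_points f.
  apply/setP=> c; rewrite !inE; have [//|c0] := eqVneq c 0%R.
  rewrite lowsum_z0 // F2_addv_eq0 /= andbT.
  by have [->|->] := lowsumP fI c0; rewrite eqxx ?c0 // eq_sym (negbTE c0).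
have oS : odd_points f \subset [set~ 0%R].
  by apply/subsetP=> c; rewrite !inE => /andP[].
rewrite cardsD (setIidPr oS) subnK ?subset_leq_card //.
by rewrite cardsC1 card_rV23.
Qed.

Lemma h_z0 x : h x + h (omega_act x z0) = 14.
Proof.
have [f [f' xf]] := coordinates_ex x.
have zxf := coordinates_act z0 xf.
rewrite (h_coord xf) (h_coord zxf).
have := card_odd_points_z0 (coord_inj xf).
rewrite [(z0 \o f) 0%R]/= z0E /=; have := ltn_ord (f 0%R).
by move: #|_| #|_| (nat_of_ord _) => m n k; lia.
Qed.

Lemma z0_tri i j k : 0 < i < 9 -> 0 < j < 9 -> 0 < k < 9 ->
  z0 @: tri i j k = tri (9 - k) (9 - j) (9 - i).
Proof.
have z0_lb l : 0 < l < 9 -> z0 (lb l) = lb (9 - l).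
  by move=> l9; rewrite z0E; apply: val_inj; rewrite /= !inordK; lia.
move=> i9 j9 k9; rewrite /tri !imsetU !imset_set1 !z0_lb //.
by rewrite setUC setUA setUAC.
Qed.

(** Writing labels in the opposite order turns [x0] into [x1]; this gives the parities
in [x1] without a second computation. *)
Lemma x1E : x1 = omega_act x0 z0.
Proof.
apply: val_inj; rewrite /= /x0_triples !imsetU !imset_set1 !z0_tri // !subSS !subn0.
rewrite /x1_triples; apply/setP=> A; rewrite !inE.
by do 7!(case: (A == _); rewrite ?orbT //).
Qed.

(** * Computation with boolean vectors *)

(** Evaluable copy of [F_2^3]: sums over the matrix type do not reduce, sums over
explicit lists of boolean triples do. *)
Definition bits : Type := (bool * bool * bool)%type.

Definition vec (p : bits) : V := vec3 p.1.1 p.1.2 p.2.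
Definition bits_of (u : V) : bits :=
  (u ord0 (inord 0) != 0, u ord0 (inord 1) != 0, u ord0 (inord 2) != 0)%R.

Lemma bits_ofK : cancel bits_of vec.
Proof. by move=> u; rewrite /vec /= -vec3_surj. Qed.

Lemma vecK : cancel vec bits_of.
Proof. by move=> [[a b] c]; rewrite /bits_of !vec3_coord. Qed.

Definition addb3 (p q : bits) : bits :=
  (p.1.1 (+) q.1.1, p.1.2 (+) q.1.2, p.2 (+) q.2).
Definition zero3 : bits := (false, false, false).

Lemma vecD p q : vec (addb3 p q) = (vec p + vec q)%R.
Proof. by rewrite /vec vec3D. Qed.

Lemma vec_zero : vec zero3 = 0%R.
Proof. by apply/eqP; rewrite vec3_eq0. Qed.

Lemma vec_eq0 p : (vec p == 0%R) = (p == zero3).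
Proof. by rewrite -vec_zero (inj_eq (can_inj vecK)). Qed.

(** Listed so that the vector [p] stands at position [code p]. *)
Definition bits_enum : seq bits :=
  [seq (p, c) | c <- [:: false; true], p <- [seq (a, b) | b <- [:: false; true], a <- [:: false; true]]].

Lemma mem_bits_enum p : p \in bits_enum.
Proof. by case: p => [[[] []] []]. Qed.

Definition code (p : bits) : nat := p.1.1 + 2 * p.1.2 + 4 * p.2.

Definition bits_lows (g : bits -> nat) (c : bits) : seq bits :=
  [seq u <- bits_enum | [&& u != zero3, u != c & g u < g (addb3 u c)]].

Definition bits_lowsum g c : bits := foldr addb3 zero3 (bits_lows g c).

Lemma lowsum_vec (f : V -> 'I_8) g c : (forall p, f (vec p) = g p :> nat) ->
  lowsum f (vec c) = vec (bits_lowsum g c).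
Proof.
move=> fg; have vI := can_inj vecK.
rewrite /lowsum (reindex vec); last by exists bits_of => u _; rewrite ?vecK ?bits_ofK.
have -> : (\sum_(p | vec p \in lows f (vec c)) vec p = \sum_(p <- bits_lows g c) vec p)%R.
  rewrite big_uniq ?filter_uniq //; apply: eq_bigl => p.
  by rewrite mem_filter mem_bits_enum andbT !inE vec_eq0 (inj_eq vI) -vecD !fg.
rewrite /bits_lowsum; elim: (bits_lows g c) => [|p s IHs] /=.
  by rewrite big_nil vec_zero.
by rewrite big_cons vecD IHs.
Qed.

Definition table (s : seq nat) (p : bits) : nat := nth 0 s (code p).

(** Labels of [x0], counted from 0, on the vectors with codes 0, ..., 7. *)
Definition x0_seq := [:: 7; 0; 1; 6; 2; 5; 4; 3].
Definition x0_pos (n : nat) : bits := nth zero3 bits_enum (index n x0_seq).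

Definition x0_coord (u : V) : 'I_8 := inord (table x0_seq (bits_of u)).
Definition x0_coordV (e : 'I_8) : V := vec (x0_pos e).

Lemma x0_coord_vec p : x0_coord (vec p) = table x0_seq p :> nat.
Proof. by rewrite /x0_coord vecK inordK //; case: p => [[[] []] []]. Qed.

Lemma x0_coordK : cancel x0_coord x0_coordV.
Proof.
move=> u; rewrite -[u]bits_ofK /x0_coordV x0_coord_vec.
by case: (bits_of u) => [[[] []] []].
Qed.

Lemma x0_coordVK : cancel x0_coordV x0_coord.
Proof.
move=> e; apply: val_inj; rewrite /= /x0_coordV x0_coord_vec.
by case: e => [[|[|[|[|[|[|[|[|]]]]]]]]].
Qed.

(** All planes have the same number of lines. *)
Lemma triples_sub_eq (x y : omega240) : triples x \subset triples y -> x = y.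
Proof.
have cE (z : omega240) : #|triples z| = #|pg22_lines|.
  have [f fI ->] := fanoP z; exact/card_imset/imset_inj.
by move=> xy; apply/val_inj/eqP; rewrite eqEcard xy !cE leqnn.
Qed.

Lemma x0_coordinates : coordinates x0 x0_coord x0_coordV.
Proof.
have cI := can_inj x0_coordK.
pose y := Omega240 (is_labelled_fanoI cI).
have yc : coordinates y x0_coord x0_coordV.
  by split=> //; [exact: x0_coordK | exact: x0_coordVK].
suff -> : x0 = y by [].
have lE k : 0 < k < 9 -> lb k = x0_coord (vec (x0_pos k.-1)).
  move=> /andP[k0 k9]; rewrite -[LHS]x0_coordVK /x0_coordV inordK //.
  by rewrite prednK.
apply: triples_sub_eq; apply/subsetP=> A /=.
rewrite /x0_triples !inE -!orbA.
by do ![case/orP]; move/eqP->; rewrite /tri !lE // (mem_triples yc) !vec_eq0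
  (inj_eq (can_inj vecK)) -vecD (inj_eq (can_inj vecK)).
Qed.

(** * The only plane without descents is the base plane *)

Lemma h_x0 : h x0 = 0.
Proof.
rewrite (h_coord x0_coordinates) (_ : odd_points _ = set0); last first.
  apply/setP=> c; rewrite !inE -[c]bits_ofK vec_eq0.
  rewrite (lowsum_vec _ x0_coord_vec) vec_eq0.
  by case: (bits_of c) => [[[] []] []].
by rewrite cards0 -vec_zero x0_coord_vec.
Qed.

(** No descent at two consecutive labels different from the basepoint: the third
label on their line is even. *)
Definition ascending (g : bits -> nat) : bool :=
  all (fun p => all (fun q =>
    [&& g q == (g p).+1, p != zero3 & q != zero3] ==>
      (bits_lowsum g (addb3 p q) == addb3 p q)) bits_enum) bits_enum.

(** The labelling differs from that of [x0] by an additive map, hence has the same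
lines. *)
Definition x0_additive (g : bits -> nat) : bool :=
  all (fun p => all (fun q =>
    x0_pos (g (addb3 p q)) == addb3 (x0_pos (g p)) (x0_pos (g q))) bits_enum) bits_enum.

(** Finite check over the 5040 labellings whose basepoint is the last label. *)
Lemma ascending_additive s : s \in permutations (iota 0 7) ->
  ascending (table (7 :: s)) -> x0_additive (table (7 :: s)).
Proof.
move: s; suff /allP H : all (fun s => ascending (table (7 :: s)) ==>
    x0_additive (table (7 :: s))) (permutations (iota 0 7)).
  by move=> s /H/implyP.
by vm_compute.
Qed.

(** A basepoint below the last label could be moved up, so the basepoint is the last
label.  Then every third label [f (p + q)] on the line through two consecutive
labels is even, and the finite check applies. *)
Lemma no_descent_x0 x :
  (forall i, h x != h (omega_act x (simple_transp i)) + 1) -> x = x0.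
Proof.
move=> asc; have [f [f' xf]] := coordinates_ex x.
have fI := coord_inj xf; have vI := can_inj vecK.
have {}asc i : f' (lo i) != 0%R /\
    (f' (hi i) != 0%R -> lowsum f (f' (lo i) + f' (hi i)) != 0)%R.
  have := asc i; have := h_simple_cases xf i => /=.
  case: ifPn => [_ ->|]; first by rewrite eqxx.
  by rewrite negb_or => /andP[-> /nandP[/negPn ->|->]].
have f0 : f 0%R = 7 :> nat.
  have [lt7|le7] := ltnP (f 0%R) 7; last by have := ltn_ord (f 0%R); lia.
  have [/eqP[]] := asc (Ordinal lt7); rewrite /lo /= inord_val.
  exact: coordK xf _.
pose s := [seq f (vec p) : nat | p <- behead bits_enum].
have gE p : f (vec p) = table (7 :: s) p :> nat.
  by case: p => [[[] []] []] //; rewrite -[LHS]/(f (vec zero3) : nat) vec_zero f0.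
have sP : s \in permutations (iota 0 7).
  rewrite mem_permutations; apply: uniq_perm; rewrite ?iota_uniq //.
    rewrite map_inj_in_uniq // => p q _ _ /val_inj /fI /vI //.
  move=> n; rewrite mem_iota /= add0n; apply/mapP/idP=> [[p pP ->]|n7].
    have : f (vec p) != f 0%R by rewrite (inj_eq fI) vec_eq0; case: eqP pP => // ->.
    by rewrite -val_eqE /= f0; have := ltn_ord (f (vec p)); lia.
  have n8 : n < 8 by apply: leq_trans n7 _.
  exists (bits_of (f' (Ordinal n8))); last by rewrite bits_ofK (coordVK xf).
  have : bits_of (f' (Ordinal n8)) != zero3.
    rewrite -vec_eq0 bits_ofK; apply: contraTneq n7 => e.
    by rewrite -leqNgt -f0 -e (coordVK xf).
  by case: (bits_of _) => [[[] []] []].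
have /(ascending_additive sP) /allP add : ascending (table (7 :: s)).
  apply/allP=> p _; apply/allP=> q _; apply/implyP; rewrite -!gE.
  case/and3P=> /eqP gq p0 q0.
  have p7 : f (vec p) < 7 by rewrite -ltnS -gq ltn_ord.
  have [] := asc (Ordinal p7).
  have -> : f' (lo (Ordinal p7)) = vec p.
    by rewrite /lo /= inord_val (coordK xf).
  have -> : f' (hi (Ordinal p7)) = vec q.
    by rewrite /hi /= -gq inord_val (coordK xf).
  rewrite !vec_eq0 => _ /(_ q0) H.
  have pq0 : (vec (addb3 p q) != 0)%R.
    by rewrite vecD F2_addv_eq0 (inj_eq vI); apply: contra_eqN gq => /eqP ->; rewrite neq_ltn ltnSn.
  rewrite -(inj_eq vI) -(lowsum_vec _ gE).
  by case: (lowsumP fI pq0) => [e|->//]; move: H; rewrite -vecD e eqxx.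
have {}add u v : x0_coordV (f (u + v)%R) = (x0_coordV (f u) + x0_coordV (f v))%R.
  rewrite -[u]bits_ofK -[v]bits_ofK -vecD /x0_coordV !gE -vecD.
  by have /allP/(_ _ (mem_bits_enum (bits_of v)))/eqP -> := add _ (mem_bits_enum (bits_of u)).
have x0c := x0_coordinates.
have GI : injective (x0_coordV \o f) := inj_comp (coord_inv_inj x0c) fI.
have G0 : x0_coordV (f 0%R) = 0%R by rewrite -[LHS](addvK (x0_coordV (f 0%R))) -add addr0 F2_addvv.
apply: triples_sub_eq; apply/subsetP=> A /(triplesP xf)[u [v [u0 v0 uv ->]]].
rewrite -[f u]x0_coordVK -[f v]x0_coordVK -[f (u + v)%R]x0_coordVK (mem_triples x0c) add eqxx.
by rewrite -G0 !(inj_eq GI) u0 v0 uv.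
Qed.

(** * Height *)

Definition word_perm (c : seq 'I_7) : 'S_8 := (\prod_(i <- c) simple_transp i)%g.

Lemma perm_length_le (c : seq 'I_7) : perm_length (word_perm c) <= size c.
Proof.
rewrite /perm_length; case: ex_minnP => m _; apply.
by apply/existsP; exists (in_tuple c).
Qed.

Lemma perm_length_word w : exists2 c, w = word_perm c & size c = perm_length w.
Proof.
rewrite /perm_length; case: ex_minnP => m /existsP[c /eqP wE] _.
by exists c; rewrite ?size_tuple.
Qed.

Lemma omega_act_rcons x c i : omega_act x (word_perm (rcons c i)) =
  omega_act (omega_act x (word_perm c)) (simple_transp i).
Proof. by rewrite /word_perm -cats1 big_cat big_seq1 omega_actM. Qed.

Lemma h_word x c : h (omega_act x (word_perm c)) <= h x + size c.
Proof.
elim/last_ind: c => [|c i IHc]; first by rewrite /word_perm big_nil omega_act1 addn0.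
rewrite omega_act_rcons size_rcons.
by have := h_simple (omega_act x (word_perm c)) i; lia.
Qed.

(** Follow descents from [x]; each lowers [h] by one, and they can only stop at
[x0], where [h] is zero. *)
Lemma h_reach x : exists2 c, omega_act x0 (word_perm c) = x & size c = h x.
Proof.
elim: (h x) {-2}x (erefl (h x)) => {x} [|n IHn] x hx.
  exists [::]; last by rewrite hx.
  rewrite /word_perm big_nil omega_act1.
  by apply/esym/no_descent_x0 => i; rewrite hx addn1.
have [i hi|no] := pickP (fun i => h x == h (omega_act x (simple_transp i)) + 1).
  have [|c cE cn] := IHn (omega_act x (simple_transp i)).
    by move: hi; rewrite hx addn1 => /eqP[].
  exists (rcons c i); last by rewrite size_rcons cn (eqP hi) addn1.
  by rewrite omega_act_rcons cE -omega_actM /simple_transp tperm2 omega_act1.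
have x0E : x = x0 by apply: no_descent_x0 => i; rewrite no.
by move: hx; rewrite x0E h_x0.
Qed.

Lemma ht_h x : ht x = h x.
Proof.
rewrite /ht; case: ex_minnP => m /existsP[w /andP[/eqP wx /eqP wm]] min.
apply/eqP; rewrite eqn_leq -[X in _ && (_ <= X)]wm; apply/andP; split.
  have [c cx <-] := h_reach x; apply: leq_trans (perm_length_le c).
  by apply: min; apply/existsP; exists (word_perm c); rewrite cx !eqxx.
have [c wc <-] := perm_length_word w; rewrite -wx wc.
by have := h_word x0 c; rewrite h_x0; lia.
Qed.

(** * Signs and the action of signed permutations *)

Lemma odd_h_act x (w : 'S_8) : odd (h (omega_act x w)) = odd (h x) (+) odd_perm w.
Proof.
have [c -> _] := perm_length_word w; elim/last_ind: c => [|c i IHc].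
  by rewrite /word_perm big_nil omega_act1 odd_perm1 addbF.
have -> : odd_perm (word_perm (rcons c i)) = ~~ odd_perm (word_perm c).
  by rewrite /word_perm -cats1 big_cat big_seq1 odd_permM odd_tperm (lo_neq_hi i) addbT.
rewrite omega_act_rcons addbN -IHc.
have [->|->] := h_simple (omega_act x (word_perm c)) i; by rewrite addn1 /= ?negbK.
Qed.

Lemma eq_mod2 m n : (m = n %[mod 2]) <-> odd m = odd n.
Proof. by rewrite !modn2; case: (odd m) (odd n) => [] []. Qed.

(** [S_8] is transitive on planes, so planes whose heights have the same parity are
related by a permutation, which is necessarily even. *)
Lemma alt_orbit x y :
  y \in orbit omega_action 'Alt_('I_8) x <-> h x = h y %[mod 2].
Proof.
rewrite eq_mod2; split=> [/orbitP[w wA <-]|xy].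
  by move: wA; rewrite Alt_even /= odd_h_act => /negbTE ->; rewrite addbF.
have [w wy] := fano_trans x y; apply/orbitP; exists w => //.
move: xy; rewrite Alt_even -wy odd_h_act.
by case: (odd_perm w) (odd (h x)) => [] [].
Qed.

(** All cycles have length two, and the sign is determined by their number. *)
Lemma odd_perm_fpf_involution (T : finType) (s : {perm T}) :
  involutive s -> (forall e, s e != e) -> odd_perm s = odd #|T|./2.
Proof.
move=> sK sN.
have oE e : porbit s e = [set e; s e].
  apply/setP=> e'; rewrite !inE; apply/porbitP/orP=> [[n ->]|[]/eqP ->].
  - elim: n => [|n [/eqP IHn|/eqP IHn]]; first by left; rewrite perm1.
      by right; rewrite expgSr permM IHn.
    by left; rewrite expgSr permM IHn sK.
  - by exists 0; rewrite perm1.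
  - by exists 1.
have part : partition (porbits s) [set: T].
  apply/and3P; split.
  - rewrite -subTset; apply/subsetP=> e _; apply/bigcupP.
    by exists (porbit s e); [apply: imset_f | apply: porbit_id].
  - apply/trivIsetP=> A B /imsetP[e _ ->] /imsetP[e' _ ->]; apply: contraR.
    case/pred0Pn=> z /andP[/= ze ze'].
    by move: ze ze'; rewrite -!eq_porbit_mem => /eqP <- /eqP <-.
  - by apply/imsetP=> -[e _ /setP/(_ e)]; rewrite inE porbit_id.
have TE : #|T| = #|porbits s| * 2.
  rewrite -cardsT; apply: card_uniform_partition part => A /imsetP[e _ ->].
  by rewrite oE cards2 eq_sym sN.
by rewrite /odd_perm TE !muln2 odd_double doubleK.
Qed.

Section SignedAction.

Local Open Scope ring_scope.

Variables (x : omega240) (f : V -> 'I_8) (f' : 'I_8 -> V).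
Hypothesis xf : coordinates x f f'.
Let fI := coord_inj xf.

Lemma translate_inj (c : V) : injective (fun e => f (f' e + c)).
Proof. by move=> e1 e2 /fI /addIr /(coord_inv_inj xf). Qed.

(** The translation of [F_2^3] by [c], seen on the labels. *)
Definition translate (c : V) : 'S_8 := perm (@translate_inj c).

Lemma translateE c e : translate c e = f (f' e + c).
Proof. by rewrite permE. Qed.

Lemma odd_translate c : odd_perm (translate c) = false.
Proof.
have [->|c0] := eqVneq c 0.
  rewrite (_ : translate 0 = 1%g) ?odd_perm1 //.
  by apply/permP=> e; rewrite translateE addr0 (coordVK xf) perm1.
rewrite odd_perm_fpf_involution ?card_ord // => e.
  by rewrite !translateE (coordK xf) addvK (coordVK xf).
by rewrite translateE (coord_eqV xf) addrC eq_addv F2_addvv.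
Qed.

Variable g : {perm signed_obj}.
Hypothesis gW : g \in WD8.
Let gb := (WD8P gW).1.

Definition unsigned_perm : 'S_8 := perm (unsigned_inj gb).

Definition sign_translation : V := \sum_i (i \in sign_changes g)%:R *: f' i.

Let c := sign_translation.
Let w := (translate c * unsigned_perm)%g.

Let wE e : w e = unsigned g (f (f' e + c)).
Proof. by rewrite permM translateE permE. Qed.

Lemma wt_signed_act v : wt (signed_act v g) = wt v.
Proof.
have s0 := sum_sign_changes (WD8P gW).2.
rewrite /wt (reindex_inj (unsigned_inj gb)) /= -[RHS]addr0 -[X in _ = _ + X]s0.
by rewrite -big_split; apply: eq_bigr => i _; rewrite signed_actE.
Qed.

(** [lambda_minus x] consists of the cosets of the vectors [v] of weight [1] and
moment [0].  Adding the sign changes shifts the moment by [c]; the translation of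
the coordinates by [c] shifts it by [c] times the weight, and the two cancel. *)
Lemma moment_signed_act v : wt v = 1 ->
  moment (f' \o w^-1)%g (signed_act v g) = moment f' v.
Proof.
move=> v1; have uE i : w^-1%g (unsigned g i) = f (f' i + c).
  by apply: (canLR (permK w)); rewrite wE (coordK xf) addvK (coordVK xf).
rewrite /moment (reindex_inj (unsigned_inj gb)) /=.
transitivity (\sum_i (v ord0 i *: f' i + (i \in sign_changes g)%:R *: f' i
   + (v ord0 i + (i \in sign_changes g)%:R) *: c)).
  by apply: eq_bigr => i _; rewrite signed_actE // uE (coordK xf) scalerDr [in LHS]scalerDl.
rewrite !big_split /= -/(sign_translation) -/c -scaler_suml big_split /=.
by rewrite (sum_sign_changes (WD8P gW).2) -/(wt v) v1 addr0 scale1r addvK.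
Qed.

Lemma signed_act_coset v : [set signed_act u g | u in coset8 v] = coset8 (signed_act v g).
Proof.
rewrite /coset8 -imset_comp; apply: eq_imset => k /=; apply/rowP=> j.
have [u uK Ku] := injF_bij (unsigned_inj gb).
by rewrite -(Ku j) signed_actE // [in RHS]mxE signed_actE // !mxE addrAC.
Qed.

Lemma signed_act_inj : injective (signed_act^~ g).
Proof.
move=> v v' /rowP e; apply/rowP=> i; have := e (unsigned g i).
by rewrite !signed_actE // => /addIr.
Qed.

(** Signed permutations act on the set of vectors of weight [1] and moment [0],
which determines the plane. *)
Lemma wd8_actE : wd8_act x g = omega_act x w.
Proof.
apply: lambda_minus_inj; rewrite lambda_minus_act //.
have [fK f'K xE] := xf; have [wfK wf'K wxE] := coordinates_act w xf.
have [r rK Kr] := injF_bij signed_act_inj.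
apply/setP=> C; apply/imsetP/(lambda_minusP _ wfK wf'K wxE) => [[D]|[v -> [v1 v0]]].
  case/(lambda_minusP _ fK f'K xE) => v -> [v1 v0] ->; rewrite signed_act_coset.
  by exists (signed_act v g); rewrite // wt_signed_act moment_signed_act.
rewrite -(Kr v) in v1 v0 *; exists (coset8 (r v)); last by rewrite signed_act_coset.
apply/(lambda_minusP _ fK f'K xE); exists (r v) => //.
by rewrite wt_signed_act in v1; rewrite moment_signed_act in v0.
Qed.

Lemma odd_h_wd8_act : odd (h (wd8_act x g)) = odd (h x) (+) odd_perm unsigned_perm.
Proof. by rewrite wd8_actE odd_h_act odd_permM odd_translate. Qed.

End SignedAction.

Lemma reflection_parity x r : is_reflection r -> odd (h (wd8_act x r)) = ~~ odd (h x).
Proof.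
move=> rr; have [f [f' xf]] := coordinates_ex x.
have rW := is_reflection_WD8 rr; rewrite (odd_h_wd8_act xf rW).
have [i [j [ij rE]]] : exists i j, i != j /\ unsigned r =1 tperm i j.
  move: rr => /existsP[i /existsP[j /andP[ij rE]]]; exists i, j; split=> // e.
  by case/orP: rE => /eqP ->; rewrite /unsigned ?wd8_transpE ?wd8_signed_transpE.
have -> : unsigned_perm rW = tperm i j by apply/permP=> e; rewrite permE rE.
by rewrite odd_tperm ij addbT.
Qed.

Lemma pure_sign_change_parity x t : is_pure_sign_change t ->
  odd (h (wd8_act x t)) = odd (h x).
Proof.
case/andP=> tW /forallP tp; have [f [f' xf]] := coordinates_ex x.
rewrite (odd_h_wd8_act xf tW).
have -> : unsigned_perm tW = 1%g.
  apply/permP=> e; rewrite permE perm1 /unsigned.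
  by have := tp e; rewrite !inE => /orP[]/eqP ->.
by rewrite odd_perm1 addbF.
Qed.

(** * Reversal of the Bruhat order and extreme heights *)

(** If [y = t x], then [z0 x = t' (z0 y)] for the conjugate [t'] of the
transposition [t] by [z0], and the heights are reversed. *)
Lemma bruhat_step_z0 x y : bruhat_step x y ->
  bruhat_step (omega_act y z0) (omega_act x z0).
Proof.
case/existsP=> i /existsP[j /and3P[ij /eqP yE lt]].
apply/existsP; exists (z0 i); apply/existsP; exists (z0 j).
rewrite (inj_eq perm_inj) ij /=; apply/andP; split.
  apply/eqP; rewrite yE -!omega_actM; congr omega_act.
  by rewrite -tpermJ conjgE mulKVg mulgA tperm2 mul1g.
move: lt; rewrite !ht_h; have := h_z0 x; have := h_z0 y; lia.
Qed.

Lemma bruhat_le_z0 x y : bruhat_le x y ->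
  bruhat_le (omega_act y z0) (omega_act x z0).
Proof.
case/connectP=> p; elim: p x => [|z p IHp] x /=; first by move=> _ ->; apply: connect0.
case/andP=> xz zp yE; apply: connect_trans (IHp _ zp yE) _.
exact/connect1/bruhat_step_z0.
Qed.

(** At the extreme values of [h] there is no room for a label of the other parity. *)
Lemma h_eq0_even x e : h x = 0 -> e \in labels x -> even_label x e.
Proof.
have [f [f' xf]] := coordinates_ex x.
rewrite (h_coord xf) -[e](coordVK xf) (labels_coord xf) => h0 c0.
rewrite (even_labelE xf) //; move: (f' e) c0 => c c0.
have /cards0_eq/setP/(_ c) : #|odd_points f| = 0 by lia.
by rewrite !inE c0 /=; have [->|->//] := lowsumP (coord_inj xf) c0; rewrite eqxx.
Qed.

Lemma h_eq14_odd x e : h x = 14 -> e \in labels x -> odd_label x e.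
Proof.
have [f [f' xf]] := coordinates_ex x.
rewrite (h_coord xf) -[e](coordVK xf) (labels_coord xf) => h14 c0.
rewrite (odd_labelE xf) //; have := card_odd_points_z0 (coord_inj xf) => o7.
have /cards0_eq/setP/(_ (f' e)) : #|odd_points (z0 \o f)| = 0 by lia.
rewrite !inE c0 lowsum_z0 ?F2_addv_eq0 //=; last exact: coord_inj xf.
by have [->//|->] := lowsumP (coord_inj xf) c0; rewrite eqxx.
Qed.

(** * The theorem *)

Lemma parity_well_defined x e : e \in labels x ->
  (exists a b : {ffun 'I_3 -> 'I_8}, is_star x e a b) /\
  ((forall a b : {ffun 'I_3 -> 'I_8}, is_star x e a b ->
      odd_for x a b /\ ~ even_for x a b) \/
   (forall a b : {ffun 'I_3 -> 'I_8}, is_star x e a b ->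
      even_for x a b /\ ~ odd_for x a b)).
Proof.
have [f [f' xf]] := coordinates_ex x; rewrite -[e](coordVK xf) (labels_coord xf).
move: (f' e) => {e}c c0; split; first exact: star_ex xf _ c0.
have [S0|Sc] := lowsumP (coord_inj xf) c0; [left|right] => a b st.
  by have [-> ->] := star_parity xf c0 st; rewrite S0 eqxx eq_sym; split=> //; apply/negP.
by have [-> ->] := star_parity xf c0 st; rewrite Sc eqxx; split=> //; apply/negP.
Qed.

Theorem proposition4p12 :
  (* (i) *)
  (forall (x : omega240) (e : 'I_8), e \in labels x ->
     (exists a b : {ffun 'I_3 -> 'I_8}, is_star x e a b) /\
     ((forall a b : {ffun 'I_3 -> 'I_8}, is_star x e a b ->
         odd_for x a b /\ ~ even_for x a b) \/
      (forall a b : {ffun 'I_3 -> 'I_8}, is_star x e a b ->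
         even_for x a b /\ ~ odd_for x a b))) /\
  (* (ii) *)
  ((forall e : 'I_8, e \in labels x0 -> even_label x0 e) /\
   (forall e : 'I_8, e \in labels x1 -> odd_label x1 e) /\
   h x0 = 0 /\ h x1 = 14) /\
  (* (iii) *)
  (forall (x : omega240) (i : 'I_7),
     h (omega_act x (simple_transp i)) = h x + 1 \/
     h x = h (omega_act x (simple_transp i)) + 1) /\
  (* (iv) *)
  (forall x : omega240, ht x = h x) /\
  (* (v) *)
  (forall x y : omega240,
     y \in orbit omega_action 'Alt_('I_8) x <-> ht x = ht y %[mod 2]) /\
  (* (vi) *)
  (forall (x : omega240) (r t : {perm signed_obj}),
     is_reflection r -> is_pure_sign_change t ->
     ht (wd8_act x r) = ht x + 1 %[mod 2] /\
     ht (wd8_act x t) = ht x %[mod 2]) /\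
  (* (vii) *)
  (forall x : omega240, ht x + ht (omega_act x z0) = 14) /\
  (* (viii) *)
  (forall x y : omega240, bruhat_le x y ->
     bruhat_le (omega_act y z0) (omega_act x z0)).
Proof.
split; [exact: parity_well_defined | split; [|split; [exact: h_simple|]]].
  split=> [e|]; first exact: h_eq0_even h_x0.
  have h1 : h x1 = 14 by rewrite x1E; have := h_z0 x0; rewrite h_x0.
  by split=> [e|]; [exact: h_eq14_odd | rewrite h_x0].
split; first exact: ht_h.
split=> [x y|]; first by rewrite !ht_h; apply: alt_orbit.
split=> [x r t rr tp|].
  rewrite !ht_h; split; apply/eq_mod2; last exact: pure_sign_change_parity.
  by rewrite reflection_parity // addn1.
split=> [x|]; first by rewrite !ht_h h_z0.
exact: bruhat_le_z0.
Qed.
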